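(* Let $X$ be a normal algebraic variety over $k$ and let $D$ be an effective Cartier divisor in $X$. Let $A$ be any subset of the normalized generic fiber $]X[$ of the formal completion of $X$ along $D$. Then for any $x$ in the closure of $A$ in $]X[$, there exists a sequence of points $x_n \in A$ such that $x_n \to x$.
   Context: Conventions: $k$ is an algebraically closed field, endowed with the trivial norm; a normal algebraic variety over $k$ is an irreducible, reduced, normal (separated) scheme of finite type over $k$. Normalized generic fiber $]X[$ (it depends on $D$). If $X=\mathrm{Spec}\,R$ is affine and $D=\{f=0\}$ with $f\in R$, the generic fiber $X_\eta$ of the formal completion of $X$ along $D$ is the set of functions $\nu: R\to \mathbb{R}_+\cup\{+\infty\}$ with $\nu(ab)=\nu(a)+\nu(b)$, $\nu(a+b)\ge\min\{\nu(a),\nu(b)\}$, $\nu(0)=+\infty$, $\nu=0$ on $k^*$ (the value $+\infty$ is allowed on non-zero elements), and $0<\nu(f)<+\infty$; equivalently, writing $|\cdot|=e^{-\nu}$, it is the set of multiplicative semi-norms $|\cdot|\le 1$ on $R$, trivial on $k$, with $0<|f|<1$. It carries the topology of pointwise convergence, i.e. the coarsest topology such that $|\cdot|\mapsto |g|$ is continuous for every $g\in R$. The normalized generic fiber $]X[\,\subset X_\eta$ is the subspace of those $\nu$ with $\nu(f)=1$. In general, cover $X$ by finitely many affine open sets $U_i$ on which $D$ is principal; $X_\eta$ (resp. $]X[$) is obtained by patching together the $U_{i,\eta}$ (resp. the $]U_i[$), where a point of $U_{i,\eta}$ and a point of $U_{j,\eta}$ are identified when both are restrictions of the same point of $(U_i\cap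 U_j)_\eta$, with the quotient topology. The result is independent of choices. *)

(* Defs.v *)
From HB Require Import structures.
From Stdlib Require Import Relations.
From mathcomp Require Import all_boot all_order all_algebra.
From mathcomp Require Import all_classical all_reals all_analysis.

Set Implicit Arguments.
Unset Strict Implicit.
Unset Printing Implicit Defensive.

Import Order.TTheory GRing.Theory Num.Theory.
Local Open Scope classical_set_scope.
Local Open Scope ring_scope.
Local Open Scope quotient_scope.

(** * Ringed spaces *)

Record opens (T : topologicalType) := Opens {
  oset :> set T;
  oset_open : open oset }.

Definition opens_mem (T : topologicalType) (V : opens T) (x : T) : Prop :=
  oset V x.
Coercion opens_mem : opens >-> Funclass.

Definition opens_setT (T : topologicalType) : opens T := Opens (@openT T).

Definition opens_preimage (S T : topologicalType) (f : S -> T)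
  (cf : continuous f) (V : opens T) : opens S :=
  Opens (proj1 (continuousP f) cf V (oset_open V)).

(* Sections over the empty set form the zero ring, hence comPzRingType. *)
Record ringed_space := RingedSpace {
  space :> topologicalType;
  sect : opens space -> comPzRingType;
  res : forall U V : opens space, V `<=` U -> {rmorphism sect U -> sect V};
  res_id : forall (U : opens space) (h : U `<=` U) (s : sect U),
    res h s = s;
  res_comp : forall (U V W : opens space) (hVU : V `<=` U) (hWV : W `<=` V)
    (hWU : W `<=` U) (s : sect U), res hWV (res hVU s) = res hWU s }.

(* The sections s and t coincide on U `&` V. *)
Definition agree (X : ringed_space) (U V : opens X) (s : sect U) (t : sect V) :=
  forall (W : opens X) (hU : W `<=` U) (hV : W `<=` V), res hU s = res hV t.

Definition is_sheaf (X : ringed_space) :=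
  forall (I : Type) (V : opens X) (U : I -> opens X)
    (hU : forall i, U i `<=` V) (s : forall i, sect (U i)),
    (forall x, V x -> exists i, U i x) ->
    (forall i j, agree (s i) (s j)) ->
    exists! t : sect V, forall i, res (hU i) t = s i.

Definition invertible (A : comPzRingType) (a : A) := exists b, a * b = 1.

Definition invertible_at (X : ringed_space) (U : opens X) (s : sect U) (x : X) :=
  exists (W : opens X) (h : W `<=` U), W x /\ invertible (res h s).

(** * Schemes *)

Record prime_ideal (A : comPzRingType) (p : set A) : Prop := PrimeIdeal {
  prime_ideal0 : p 0;
  prime_idealD : forall a b, p a -> p b -> p (a + b);
  prime_idealMl : forall a b, p b -> p (a * b);
  prime_ideal1 : ~ p 1;
  prime_idealM : forall a b, p (a * b) -> p a \/ p b }.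

(* g exhibits B as the ring of fractions A[1/f]. *)
Record is_localization (A B : comPzRingType) (g : A -> B) (f : A) : Prop :=
  IsLocalization {
  loc_unit : invertible (g f);
  loc_frac : forall b, exists (a : A) (n : nat), b * g f ^+ n = g a;
  loc_ker : forall a, g a = 0 -> exists n : nat, f ^+ n * a = 0 }.

(* phi and the identity of A := sect U form an isomorphism from (U, O_U) to
   Spec A; the structure sheaf of Spec A is determined by its values A[1/f] on
   the basic open sets D(f) = {p | f \notin p}. *)
Record is_spec_iso (X : ringed_space) (U : opens X) (phi : X -> set (sect U)) :
  Prop := IsSpecIso {
  spec_prime : forall x, U x -> prime_ideal (phi x);
  spec_inj : forall x y, U x -> U y -> phi x = phi y -> x = y;
  spec_surj : forall p, prime_ideal p -> exists2 x, U x & phi x = p;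
  spec_homeo : forall W : set X, W `<=` U ->
    (open W <-> forall x, W x -> exists f,
       ~ phi x f /\ forall y, U y -> ~ phi y f -> W y);
  spec_sheaf : forall (f : sect U) (W : opens X) (h : W `<=` U),
    (forall x, W x <-> U x /\ ~ phi x f) -> is_localization (res h) f }.

Definition affine (X : ringed_space) (U : opens X) :=
  exists phi : X -> set (sect U), is_spec_iso phi.

Record scheme := Scheme {
  scheme_space :> ringed_space;
  scheme_sheaf : is_sheaf scheme_space;
  scheme_affine : forall x : scheme_space,
    exists U : opens scheme_space, U x /\ affine U }.

(* A morphism X -> Spec k is the same as a ring morphism from k to the global
   sections of X. *)
Record kscheme (k : fieldType) := KScheme {
  kscheme_scheme :> scheme;
  kstr : {rmorphism k -> sect (opens_setT kscheme_scheme)} }.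

Definition kcst (k : fieldType) (X : kscheme k) (U : opens X) (c : k) : sect U :=
  res (U := opens_setT X) (@subsetT _ U) (kstr X c).

(** * Separated schemes *)

(* Morphisms of locally ringed spaces over Spec k. *)
Record kmor (k : fieldType) (X Y : kscheme k) := KMor {
  kmap :> X -> Y;
  kmap_cont : continuous kmap;
  kcom : forall V : opens Y,
    {rmorphism sect V -> sect (opens_preimage kmap_cont V)};
  kcom_res : forall (V W : opens Y) (h : W `<=` V) (s : sect V),
    agree (kcom V s) (kcom W (res h s));
  kcom_local : forall (V : opens Y) (s : sect V) (x : X), V (kmap x) ->
    invertible_at (kcom V s) x -> invertible_at s (kmap x);
  kcom_cst : forall c : k, agree (kcom (opens_setT Y) (kstr Y c)) (kstr X c) }.

Definition kmor_eq (k : fieldType) (X Y : kscheme k) (g h : kmor X Y) :=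
  (forall x, g x = h x) /\
  (forall (V : opens Y) (s : sect V), agree (kcom g V s) (kcom h V s)).

(* p \o h = g *)
Definition kmor_comp (k : fieldType) (X Y Z : kscheme k)
  (h : kmor X Y) (p : kmor Y Z) (g : kmor X Z) :=
  (forall x, p (h x) = g x) /\
  (forall (V : opens Z) (s : sect V), agree (kcom h _ (kcom p V s)) (kcom g V s)).

(* p \o d is the identity. *)
Definition kmor_section (k : fieldType) (X Y : kscheme k)
  (d : kmor X Y) (p : kmor Y X) :=
  (forall x, p (d x) = x) /\
  (forall (V : opens X) (s : sect V), agree (kcom d _ (kcom p V s)) s).

Definition is_square (k : fieldType) (X P : kscheme k) (p1 p2 : kmor P X) :=
  forall (T : kscheme k) (g1 g2 : kmor T X),
    (exists h : kmor T P, kmor_comp h p1 g1 /\ kmor_comp h p2 g2) /\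
    (forall h h' : kmor T P,
       kmor_comp h p1 g1 -> kmor_comp h p2 g2 ->
       kmor_comp h' p1 g1 -> kmor_comp h' p2 g2 -> kmor_eq h h').

Record closed_immersion (k : fieldType) (X Y : kscheme k) (d : kmor X Y) :
  Prop := ClosedImmersion {
  climm_inj : injective d;
  climm_closed : forall C : set X, closed C -> closed (d @` C);
  climm_surj : forall (V : opens Y) (s : sect (opens_preimage (@kmap_cont _ _ _ d) V))
    (y : Y), V y ->
    exists (W : opens Y) (t : sect W), [/\ W y, W `<=` V & agree (kcom d W t) s] }.

Definition separated (k : fieldType) (X : kscheme k) :=
  exists (P : kscheme k) (p1 p2 : kmor P X) (d : kmor X P),
    [/\ is_square p1 p2, kmor_section d p1, kmor_section d p2
      & closed_immersion d].

(** * Normal varieties *)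

Definition irreducible_space (T : topologicalType) :=
  (exists x : T, True) /\
  (forall U V : opens T, U !=set0 -> V !=set0 -> (U `&` V) !=set0).

Definition reduced (X : scheme) :=
  forall (U : opens X) (s : sect U) (n : nat), s ^+ n = 0 -> s = 0.

(* S, with the maps germ, is the stalk of the structure sheaf at x. *)
Record is_stalk (X : scheme) (x : X) (S : comPzRingType)
  (germ : forall U : opens X, U x -> {rmorphism sect U -> S}) : Prop := IsStalk {
  germ_res : forall (U V : opens X) (hU : U x) (hV : V x) (h : V `<=` U)
    (s : sect U), germ V hV (res h s) = germ U hU s;
  germ_surj : forall a : S,
    exists (U : opens X) (hU : U x) (s : sect U), germ U hU s = a;
  germ_inj : forall (U : opens X) (hU : U x) (s t : sect U),
    germ U hU s = germ U hU t ->
    exists (W : opens X) (h : W `<=` U), W x /\ res h s = res h t }.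

Definition integrally_closed (S : idomainType) :=
  forall z : {fraction S}, integralOver (@FracField.tofrac S) z ->
    exists a : S, z = FracField.tofrac a.

Definition normal_scheme (X : scheme) :=
  forall x : X, exists (S : idomainType)
    (germ : forall U : opens X, U x -> {rmorphism sect U -> S}),
    is_stalk germ /\ integrally_closed S.

Definition fin_gen_algebra (k : fieldType) (A : comPzRingType) (c : k -> A) :=
  exists gen : seq A, forall P : set A,
    (forall l, P (c l)) -> (forall a, a \in gen -> P a) ->
    (forall a b, P a -> P b -> P (a + b)) ->
    (forall a b, P a -> P b -> P (a * b)) ->
    forall a, P a.

Definition finite_type (k : fieldType) (X : kscheme k) :=
  exists (n : nat) (U : 'I_n -> opens X),
    (forall x : X, exists i, U i x) /\
    (forall i, affine (U i) /\ fin_gen_algebra (@kcst k X (U i))).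

Record normal_variety (k : fieldType) (X : kscheme k) : Prop := NormalVariety {
  variety_irreducible : irreducible_space X;
  variety_reduced : reduced X;
  variety_normal : normal_scheme X;
  variety_separated : separated X;
  variety_finite_type : finite_type X }.

(** * Effective Cartier divisors *)

(* Restricted to U, the ideal sheaf J is generated by f. *)
Definition principal_on (X : scheme) (J : forall U : opens X, set (sect U))
  (U : opens X) (f : sect U) :=
  forall (V : opens X) (h : V `<=` U) (s : sect V),
    J V s <-> exists a, s = a * res h f.

(* A divisor is given by its ideal sheaf, which is required to be locally
   generated by one non-zero-divisor. *)
Record cartier_divisor (X : scheme) := CartierDivisor {
  divideal : forall U : opens X, set (sect U);
  divideal0 : forall U, divideal (0 : sect U);
  dividealD : forall U (s t : sect U),
    divideal s -> divideal t -> divideal (s + t);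
  dividealMl : forall U (s t : sect U), divideal t -> divideal (s * t);
  divideal_res : forall (U V : opens X) (h : V `<=` U) (s : sect U),
    divideal s -> divideal (res h s);
  divideal_loc : forall (U : opens X) (s : sect U),
    (forall x, U x -> exists (W : opens X) (h : W `<=` U),
       W x /\ divideal (res h s)) -> divideal s;
  divideal_principal : forall x : X, exists (U : opens X) (f : sect U),
    [/\ U x, principal_on divideal f
      & forall (V : opens X) (h : V `<=` U) (a : sect V),
          a * res h f = 0 -> a = 0] }.

(** * The normalized generic fiber *)

Record semivaluation (k : fieldType) (R : realType) (A : comPzRingType)
  (c : k -> A) (v : A -> \bar R) : Prop := Semivaluation {
  semival_ge0 : forall a, (0 <= v a)%E;
  semivalM : forall a b, v (a * b) = (v a + v b)%E;
  semivalD : forall a b, (Order.min (v a) (v b) <= v (a + b)%R)%E;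
  semival0 : v 0 = +oo%E;
  semival_cst : forall l : k, l != 0 -> v (c l) = 0%E }.

(* For U affine and D = {f = 0} on U, the points of U_eta. *)
Definition eta_point (k : fieldType) (R : realType) (X : kscheme k)
  (U : opens X) (f : sect U) (v : sect U -> \bar R) :=
  semivaluation (@kcst k X U) v /\ (0 < v f < +oo)%E.

(* ]U[, whose topology is induced by pointwise convergence. *)
Definition normalized_points (k : fieldType) (R : realType) (X : kscheme k)
  (U : opens X) (f : sect U) : set {ptws sect U -> \bar R} :=
  [set v | eta_point f v /\ v f = 1%:E].

Arguments normalized_points {k} R {X U} f.

Record principal_cover (k : fieldType) (X : kscheme k) (D : cartier_divisor X) :=
  PrincipalCover {
  cov_size : nat;
  cov_open : 'I_cov_size -> opens X;
  cov_eq : forall i, sect (cov_open i);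
  cov_affine : forall i, affine (cov_open i);
  cov_principal : forall i, principal_on (@divideal X D) (cov_eq i);
  cov_cover : forall x : X, exists i, cov_open i x }.

Arguments cov_open {k X D} C i : rename.
Arguments cov_eq {k X D} C i : rename.

Section NormalizedGenericFiber.
Context (k : fieldType) (R : realType) (X : kscheme k) (D : cartier_divisor X).
Context (C : principal_cover D).

Definition chart_points : topologicalType :=
  {i : 'I_(cov_size C) & set_type (normalized_points R (cov_eq C i))}.

(* a and b are restrictions of the same point of (U_i `&` U_j)_eta, which is
   itself given by a point w of W_eta for an affine open W in U_i `&` U_j. When
   X is separated, W = U_i `&` U_j is affine and gives all identifications,
   since points of W_eta restrict to points of (U_i `&` U_j)_eta. *)
Definition same_point (a b : chart_points) : Prop :=
  exists (W : opens X) (ha : W `<=` cov_open C (tag a))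
    (hb : W `<=` cov_open C (tag b)) (w : sect W -> \bar R),
    [/\ affine W,
        eta_point (res ha (cov_eq C (tag a))) w,
        (forall s, set_val (tagged a) s = w (res ha s))
      & (forall s, set_val (tagged b) s = w (res hb s))].

Definition patched (a b : chart_points) : bool :=
  `[< clos_refl_sym_trans chart_points same_point a b >].

Lemma patched_equiv : equiv_class_of patched.
Proof.
split=> [a|a b|b a c].
- by apply/asboolP; exact: rst_refl.
- by apply/asboolP/asboolP; exact: rst_sym.
- by move=> /asboolP ab /asboolP bc; apply/asboolP; exact: rst_trans ab bc.
Qed.

Canonical patched_equivRel := EquivRelPack patched_equiv.

(* ]X[, with the quotient topology. *)
Definition normalized_generic_fiber : topologicalType :=
  quotient_topology {eq_quot patched_equivRel}.

End NormalizedGenericFiber.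

(* Main.v *)
Require Import Defs.
From HB Require Import structures.
From Stdlib Require Import Relations.
From mathcomp Require Import all_boot all_order all_algebra.
From mathcomp Require Import all_classical all_reals all_analysis.
From mathcomp Require Import ring.

Set Implicit Arguments.
Unset Strict Implicit.
Unset Printing Implicit Defensive.

Import Order.TTheory GRing.Theory Num.Theory.
Local Open Scope classical_set_scope.
Local Open Scope ring_scope.

(** A point of the generic fiber is, on an affine chart, a semivaluation of a
    ring of sections [A], and convergence is pointwise on [A]. When [k] is
    uncountable this topology need not be metrizable, and the point of the proof
    is that countably many elements of [A] suffice to test the convergence of a
    well-chosen sequence.

    On a chart, [A] has countable dimension over [k], so that a semivaluation is
    given by an ultrametric function on the space [{poly k}]. Such a function has
    an orthogonal basis of monic polynomials, one in each degree
    ([orthogonal_basis_exists]). If the coefficients of this basis lie in a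
    subfield [S], the value at a polynomial [p] is the smallest of the values at
    finitely many polynomials over [S], which depend on [p] and [S] only
    ([free_decomposition], [ultra_free_combination]). Given a limit point [a] of
    a set [B], close off: adjoin to [S] the coefficients of the basis of [a], for
    each finite set of conditions over [S] choose an element of [B] that
    approximates [a] on it, adjoin the coefficients of its basis, and iterate
    ([closed_enumeration]). As only countably many coefficients are adjoined,
    [S] stays countable; some sequence of the chosen elements converges to [a] on
    the polynomials over [S], hence everywhere ([ultrametric_sequence]).

    Charts are compact but not open in the patched space. It is enough that
    closed subsets of charts have closed images there: then the images of the
    closures of the traces of [A] on the finitely many charts are closed and
    cover [A], and [x] comes from the closure of one of these traces, so that the
    first part applies. Let [N] be the intersection of the charts [U] and [V].
    Two points of [U] and [V] are identified exactly when some semivaluation of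
    the sections over [N] extends both ([patchedP]). As the semivaluations over
    [N] form a compact space, the identification is closed ([patched_closed]).

    If two points are identified, they have the same center and the same
    extension to the local ring of the center ([local_data]), which contains the
    sections over [N]. Conversely, a semivaluation over [N] has a center in [U]
    and one in [V], which are the same point of [N] because [X] is separated:
    the spectrum [T] of the domain of sections over [N] maps to [U] and to [V],
    and both morphisms to [X] agree at the generic point of [T], hence everywhere
    ([separated_affine_points]). A principal open neighborhood of the center
    inside [N] is then an affine open set on which the two points have a common
    extension. All rings of sections embed in the function field of [X],
    where these comparisons take place. *)

(** * Orthogonal bases of ultrametric functions *)

Section Ultrametric.
Context (k : fieldType) (R : realType).

Record ultrametric (w : {poly k} -> \bar R) : Prop := Ultrametric {
  ultra0 : w 0 = +oo%E;
  ultraD : forall p q : {poly k}, (Order.min (w p) (w q) <= w (p + q))%O;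
  ultraZ : forall (a : k) (p : {poly k}), a != 0 -> w (a *: p) = w p }.

Definition orthogonal_basis (w : {poly k} -> \bar R) (b : nat -> {poly k}) :=
  forall n, [/\ b n \is monic, size (b n) = n.+1 &
    forall q : {poly k}, (size q <= n)%N ->
      w (b n + q) = Order.min (w (b n)) (w q)].

Lemma ultra_lt w p q : ultrametric w -> (w p < w q)%O -> w (p + q) = w p.
Proof.
move=> uw pq; apply/eqP; rewrite eq_le; apply/andP; split; last first.
  by have := ultraD uw p q; rewrite (min_idPl (ltW pq)).
have wN : w (- q) = w q by rewrite -scaleN1r ultraZ // oppr_eq0 oner_eq0.
have := ultraD uw (p + q) (- q); rewrite addrK wN ge_min => /orP[//|].
by rewrite leNgt pq.
Qed.

(** The difference of two monic polynomials of degree [n] has smaller degree, so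
    that all values of [w] on these polynomials, except perhaps the largest one,
    already occur in degree less than [n]. When only finitely many values occur
    there, the largest value is attained, and a polynomial that attains it is
    orthogonal to all polynomials of smaller degree. *)
Lemma ultra_best w n (vals : seq (\bar R)) : ultrametric w ->
  (forall p : {poly k}, (size p <= n)%N -> w p \in vals) ->
  exists b : {poly k}, [/\ b \is monic, size b = n.+1 &
    forall q : {poly k}, (size q <= n)%N -> w (b + q) = Order.min (w b) (w q)].
Proof.
move=> uw hvals.
have [b [bm bs bmax]] : exists b : {poly k}, [/\ b \is monic, size b = n.+1 &
    forall q : {poly k}, (size q <= n)%N -> (w (b + q) <= w b)%O].
  have [N] : exists N, (size [seq v <- vals | (w 'X^n <= v)%O] < N)%N.
    by eexists; exact: ltnSn.
  have : 'X^n \is @monic k /\ size ('X^n : {poly k}) = n.+1.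
    by rewrite monicXn size_polyXn.
  move: ('X^n : {poly k}) => b.
  (* Each improvement of [b] discards the value [w b] from [vals]. *)
  elim: N b => // N IH b [bm bs]; rewrite ltnS => hN.
  have [/existsNP[q /not_implyP[sq /negP]]|] :=
      pselect (~ forall q : {poly k}, (size q <= n)%N -> (w (b + q) <= w b)%O); last first.
    by move=> /contrapT H; exists b.
  rewrite -ltNge => ltb.
  have sb : size (b + q) = n.+1 by rewrite size_polyDl bs.
  apply: (IH (b + q)).
    by split=> //; rewrite monicE lead_coefDl ?bs //; exact/eqP/monicP.
  have wq : w q = w b.
    have wN : w (- b) = w b by rewrite -scaleN1r ultraZ // oppr_eq0 oner_eq0.
    have -> : q = - b + (b + q) by rewrite addKr.
    by rewrite (ultra_lt uw) wN.
  have := hvals _ sq; rewrite wq => wbv.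
  apply: leq_trans hN.
  rewrite !size_filter; set bq := b + q in ltb *.
  have -> : count (fun v : \bar R => (w b <= v)%O) vals =
    (count (fun v : \bar R => (w bq <= v)%O) vals +
      count (fun v : \bar R => (w b <= v < w bq)%O) vals)%N.
    elim: (vals) => //= v s ->.
    by case: (leP (w bq) v) => [wv|_]; rewrite ?(ltW (lt_le_trans ltb wv));
      case: (w b <= v)%O; rewrite /= ?add0n ?addnA ?add1n ?addn1 ?addnS.
  rewrite -addn1 leq_add2l -has_count; apply/hasP.
  by exists (w b) => //; rewrite lexx.
exists b; split=> // q sq.
have [bq|qb|bq] := ltgtP (w b) (w q).
- exact: ultra_lt.
- by rewrite addrC ultra_lt.
apply/eqP; rewrite eq_le; apply/andP; split; first exact: bmax.
by have := ultraD uw b q; rewrite -bq minxx.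
Qed.

(** In degree less than [n], only the values of the first [n] basis elements and
    [+oo] occur, which supplies the finiteness for the next step. *)
Lemma orthogonal_basis_exists w : ultrametric w ->
  exists b, orthogonal_basis w b.
Proof.
move=> uw.
suff H n : exists vals : seq (\bar R),
    forall p : {poly k}, (size p <= n)%N -> w p \in vals.
  have /choice[b hb] : forall n, exists b : {poly k}, [/\ b \is monic,
      size b = n.+1 & forall q : {poly k}, (size q <= n)%N ->
        w (b + q) = Order.min (w b) (w q)].
    by move=> n; have [vals hv] := H n; exact: ultra_best hv.
  by exists b.
elim: n => [|n [vals hv]].
  by exists [:: +oo%E] => p; rewrite leqn0 size_poly_eq0 => /eqP ->;
    rewrite (ultra0 uw) mem_head.
have [b [bm bs bo]] := ultra_best uw hv.
exists (w b :: vals) => p sp.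
have [c0|c0] := eqVneq p`_n 0.
  rewrite inE hv ?orbT //; apply/leq_sizeP => j.
  by rewrite leq_eqVlt => /predU1P[<- //|nj]; apply: nth_default; apply: leq_trans nj.
have bn : b`_n = 1 by have /monicP := bm; rewrite lead_coefE bs.
set q := p - p`_n *: b.
have sq : (size q <= n)%N.
  apply/leq_sizeP => j; rewrite leq_eqVlt coefB coefZ => /predU1P[<-|nj].
    by rewrite bn mulr1 subrr.
  by rewrite [p`_j]nth_default ?[b`_j]nth_default ?mulr0 ?subrr ?bs //;
      exact: leq_trans sp nj.
have -> : p = p`_n *: (b + (p`_n)^-1 *: q).
  by rewrite scalerDr scalerA divff // scale1r addrC subrK.
rewrite ultraZ // bo ?size_scale ?invr_eq0 // ultraZ ?invr_eq0 //.
by rewrite inE /Order.min; case: ifP => _; rewrite ?eqxx // hv ?orbT.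
Qed.

(** * Free decompositions over a subfield *)

Definition free_over (S : {pred k}) (m : nat) (mu : nat -> k) :=
  forall d : nat -> k, (forall j, d j \in S) ->
    \sum_(j < m) mu j * d j = 0 -> forall j, (j < m)%N -> d j = 0.

(** Decompose the coefficients of [p] one after the other: a coefficient that is
    not a combination over [S] of the elements found before is added to them. *)
Lemma free_decomposition (S : divringClosed k) (p : {poly k}) :
  exists (m : nat) (mu : nat -> k) (q : nat -> {poly k}),
    [/\ free_over S m mu, forall j, q j \is a polyOver S &
        p = \sum_(j < m) mu j *: q j].
Proof.
elim/poly_ind: p => [|p c [m [mu [q [fr qS ->]]]]].
  exists 0%N, (fun=> 0), (fun=> 0); split=> //; last by rewrite big_ord0.
  by move=> j; exact: rpred0.
have XS : 'X \is a polyOver S by exact: polyOverX.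
have [[d dS cE]|nc] := pselect (exists2 d : nat -> k,
    (forall j, d j \in S) & c = \sum_(j < m) mu j * d j).
  exists m, mu, (fun j => q j * 'X + (d j)%:P); split=> //.
    by move=> j; rewrite rpredD ?rpredM // polyOverC.
  rewrite mulr_suml cE rmorph_sum /= -big_split /=; apply: eq_bigr => j _.
  by rewrite scalerDr scalerAl polyCM mul_polyC.
pose mu' j := if j == m then c else mu j.
pose q' j := if j == m then 1 else q j * 'X.
have mu'E (j : 'I_m) : mu' j = mu j by rewrite /mu' ltn_eqF.
exists m.+1, mu', q'; split.
- move=> d dS; rewrite big_ord_recr /= {2}/mu' eqxx.
  under eq_bigr do rewrite mu'E.
  move=> s0; have [dm0|dm0] := eqVneq (d m) 0.
    move=> j; rewrite ltnS leq_eqVlt => /predU1P[-> //|]; apply: fr => //.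
    by move: s0; rewrite dm0 mulr0 addr0.
  case: nc; exists (fun j => - (d j / d m)).
    by move=> j; rewrite rpredN rpred_div.
  apply: (mulIf dm0); rewrite mulr_suml.
  under eq_bigr do rewrite mulrN mulNr -mulrA divfK //.
  by rewrite sumrN; apply/eqP; rewrite -addr_eq0 addrC s0.
- by move=> j; rewrite /q'; case: ifP => _; rewrite ?rpred1 // rpredM.
rewrite big_ord_recr /= {2}/mu' {2}/q' eqxx alg_polyC mulr_suml; congr (_ + _).
by apply: eq_bigr => j _; rewrite mu'E /q' ltn_eqF // scalerAl.
Qed.

(** If an orthogonal basis of [w] has coefficients in the subfield [S], then
    the balls of [w] are defined over [S]: the coordinates of a combination
    [\sum_j mu j *: q j] in this basis are combinations over [S] of the [mu j],
    so that such a coordinate vanishes only if it vanishes for all [q j]. *)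
Lemma ultra_free_combination (S : divringClosed k) w b m mu
    (q : nat -> {poly k}) : ultrametric w ->
  orthogonal_basis w b -> (forall n, b n \is a polyOver S) ->
  free_over S m mu -> (forall j, q j \is a polyOver S) ->
  forall x, (x <= w (\sum_(j < m) mu j *: q j)%R)%O <->
            (forall j : 'I_m, (x <= w (q j))%O).
Proof.
move=> uw ob bS fr qS x.
have [n] : exists n, forall j : 'I_m, (size (q j) <= n)%N.
  by exists (\max_(j < m) size (q j)) => j; exact: leq_bigmax.
elim: n q qS => [|n IH] q qS sq.
  have q0 (j : 'I_m) : q j = 0 by apply/eqP; rewrite -size_poly_leq0.
  rewrite big1 => [|j _]; last by rewrite q0 scaler0.
  by rewrite (ultra0 uw) leey; split=> // _ j; rewrite q0 (ultra0 uw) leey.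
have [bm bs bo] := ob n.
have bn : (b n)`_n = 1 by have /monicP := bm; rewrite lead_coefE bs.
pose q' j := q j - (q j)`_n *: b n.
have q'S j : q' j \is a polyOver S.
  by rewrite rpredB ?polyOverZ //; exact: (polyOverP (qS j)).
have szlow (p : {poly k}) : (size p <= n.+1)%N ->
    (size (p - p`_n *: b n)%R <= n)%N.
  move=> sp; apply/leq_sizeP => i.
  rewrite leq_eqVlt coefB coefZ => /predU1P[<-|ni].
    by rewrite bn mulr1 subrr.
  by rewrite [p`_i]nth_default ?[(b n)`_i]nth_default ?mulr0 ?subrr ?bs //;
    exact: leq_trans sp ni.
have val (p : {poly k}) : (size p <= n.+1)%N -> (x <= w p)%O <->
    ((p`_n != 0 -> (x <= w (b n))%O) /\ (x <= w (p - p`_n *: b n)%R)%O).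
  move=> sp; have [->|c0] := eqVneq p`_n 0.
    by rewrite scale0r subr0; split=> [? //|[]].
  rewrite -{1}[p](subrK (p`_n *: b n)) addrC.
  set r := p - _; have sr := szlow p sp; rewrite -/r in sr.
  rewrite -[r in w (_ + r)]scale1r -(divff c0) -scalerA -scalerDr ultraZ //.
  rewrite bo ?size_scale ?invr_eq0 // ultraZ ?invr_eq0 // le_min.
  by split=> [/andP[] //|[h1 ->]]; rewrite h1.
have sS : (size (\sum_(j < m) mu j *: q j)%R <= n.+1)%N.
  apply: leq_trans (size_sum _ _ _) _; apply/bigmax_leqP => j _.
  by apply: leq_trans (size_scale_leq _ _) _.
rewrite val //.
have -> : \sum_(j < m) mu j *: q j - (\sum_(j < m) mu j *: q j)`_n *: b n =
    \sum_(j < m) mu j *: q' j.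
  rewrite coef_sum scaler_suml -sumrB; apply: eq_bigr => j _.
  by rewrite coefZ scalerBr scalerA.
rewrite IH //; last by move=> j; exact: szlow.
have cE : (\sum_(j < m) mu j *: q j)`_n = \sum_(j < m) mu j * (q j)`_n.
  by rewrite coef_sum; apply: eq_bigr => j _; rewrite coefZ.
split=> [[h1 h2] j|h].
  apply/val => //; split; last exact: h2.
  move=> c0; apply: h1; apply: contraNneq c0 => s0; apply/eqP.
  apply: (fr (fun j => (q j)`_n)) => // [i|]; first exact: (polyOverP (qS i)).
  by rewrite -cE.
split; last by move=> j; have /val[] := h j.
rewrite cE => s0; have [j c0] : exists j : 'I_m, (q j)`_n != 0.
  apply: contrapT => /forallNP c0; move/eqP: s0; apply; apply: big1 => j _.
  by have /negP/negPn/eqP -> := c0 j; rewrite mulr0.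
by have /val[// | + _] := h j; apply.
Qed.

End Ultrametric.

(** * Countable closure *)

(** Closed terms over countably many operation symbols are countable, and their
    values form a set that is closed under the operations. *)
Lemma closed_enumeration (T : Type) (I : countType) (x0 : T)
  (op : I -> seq T -> T) :
  exists kap : nat -> T, forall i (l : seq nat),
    exists n, kap n = op i [seq kap m | m <- l].
Proof.
pose ev := fix ev (t : GenTree.tree unit) : T :=
  if t is GenTree.Node n s then
    if unpickle n is Some i then op i [seq ev u | u <- s] else x0
  else x0.
pose term n : GenTree.tree unit :=
  if unpickle n is Some t then t else GenTree.Leaf tt.
exists (ev \o term) => i l.
exists (pickle (GenTree.Node (pickle i) [seq term m | m <- l])).
by rewrite /= {1}/term pickleK /= pickleK -map_comp.
Qed.

Section AllSeqs.
Context (k : fieldType).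

Fixpoint seqs_over (l : seq k) (n : nat) : seq (seq k) :=
  if n is n'.+1 then [seq x :: s | x <- l, s <- seqs_over l n'] else [:: [::]].

Lemma mem_seqs_over l n s :
  size s = n -> {subset s <= l} -> s \in seqs_over l n.
Proof.
elim: n s => [|n IH] [|x s] //= [sn] sl.
apply/allpairsP; exists (x, s); split=> //=; first by apply: sl; rewrite mem_head.
by apply: IH => // y ys; apply: sl; rewrite inE ys orbT.
Qed.

Lemma mem_polys_over (l : seq k) n (p : {poly k}) : (size p <= n)%N ->
  (forall i, p`_i \in l) -> p \in [seq Poly s | s <- seqs_over l n].
Proof.
move=> sp pl; apply/mapP; exists (mkseq (nth 0 p) n).
  apply: mem_seqs_over; first by rewrite size_mkseq.
  by move=> x /mapP[i _ ->]; exact: pl.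
apply/polyP => i; rewrite coef_Poly; have [ni|ni] := ltnP i n.
  by rewrite nth_mkseq.
by rewrite !nth_default ?size_mkseq //; exact: leq_trans sp ni.
Qed.

End AllSeqs.

Section SubfieldOfRange.
Context (k : fieldType) (kap : nat -> k).

Definition range_pred : {pred k} := [pred x | `[< exists n, kap n = x >]].

Hypothesis kap_closed : divring_closed range_pred.

Definition range_subfield : divringClosed k :=
  HB.pack range_pred (GRing.isDivringClosed.Build _ range_pred kap_closed).
End SubfieldOfRange.

(** * Sequential approximation of ultrametric functions *)

(** For all ultrametric functions defined over a countable subfield, the value
    at any polynomial is the smallest of the values at finitely many polynomials
    over this subfield, which do not depend on the function. Thus convergence
    has to be tested only on a countable set, provided that the limit and the
    terms of the sequence are defined over the subfield. Such a subfield exists,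
    as each choice of an approximant adds only countably many coefficients. *)
Lemma ultrametric_sequence (k : fieldType) (R : realType)
  (B : set ({poly k} -> \bar R)) (a : {poly k} -> \bar R) :
  ultrametric a -> (forall w, B w -> ultrametric w) ->
  (forall (G : seq {poly k}) (e : R), 0 < e ->
    exists2 w, B w & forall g, g \in G -> ball (a g) e (w g)) ->
  exists u : nat -> {poly k} -> \bar R,
    (forall n, B (u n)) /\ forall p, u n p @[n --> \oo] --> a p.
Proof.
move=> ua uB clB.
have [ba oba] := orthogonal_basis_exists ua.
have /choice[pick hpick] : forall l : seq k, exists w, B w /\
    forall p : {poly k}, (size p <= size l)%N -> (forall i, p`_i \in l) ->
      ball (a p) ((size l).+1%:R^-1) (w p).
  move=> l; have e0 : 0 < ((size l).+1%:R^-1 : R) by rewrite invr_gt0 ltr0n.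
  have [w Bw hw] := clB [seq Poly s | s <- seqs_over l (size l)] _ e0.
  by exists w; split=> // p sp pl; apply: hw; exact: mem_polys_over.
have /choice[bs obs] : forall l, exists b, orthogonal_basis (pick l) b.
  by move=> l; have [Bl _] := hpick l; exact/orthogonal_basis_exists/uB.
(* Codes 0, 1 and 2 make the set closed under subtraction and division; codes 3
   and 4 add the coefficients of the bases of [a] and of the approximants. *)
pose op (c : nat * nat * nat) (l : seq k) : k :=
  let: (c, n, i) := c in
  match c with
  | 0 => 1
  | 1 => l`_0 - l`_1
  | 2 => l`_0 / l`_1
  | 3 => (ba n)`_i
  | _ => (bs l n)`_i
  end.
have [kap kapP] := closed_enumeration 0 op.
have kcl : divring_closed (range_pred kap).
  split.
  - by apply/asboolP; have [n] := kapP (0, 0, 0)%N [::]; exists n.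
  - move=> _ _ /asboolP[m <-] /asboolP[n <-]; apply/asboolP.
    by have [j] := kapP (1, 0, 0)%N [:: m; n]; exists j.
  - move=> _ _ /asboolP[m <-] /asboolP[n <-]; apply/asboolP.
    by have [j] := kapP (2, 0, 0)%N [:: m; n]; exists j.
pose S := range_subfield kcl.
have SE x : (x \in S) = `[< exists n, kap n = x >] by [].
have baS n : ba n \is a polyOver S.
  apply/polyOverP => i; rewrite SE; apply/asboolP.
  by have [j] := kapP (3, n, i)%N [::]; exists j.
pose u N := pick (mkseq kap N).
have uS N n : bs (mkseq kap N) n \is a polyOver S.
  apply/polyOverP => i; rewrite SE; apply/asboolP.
  by have [j] := kapP (4, n, i)%N (iota 0 N); exists j.
have cvS p : p \is a polyOver S -> u n p @[n --> \oo] --> a p.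
  move=> pS.
  (* From [N0] on, all coefficients of [p], and 0, occur among the first [n]
     elements of the subfield. *)
  have [N0 hN0] : exists N0, forall x, x \in 0 :: (p : seq k) ->
      exists2 m, (m < N0)%N & kap m = x.
    have : {subset 0 :: (p : seq k) <= S}.
      move=> x; rewrite inE => /predU1P[->|]; first exact: rpred0.
      by move=> /(nthP 0)[i _ <-]; exact: (polyOverP pS).
    elim: (0 :: _) => [|x s IH] sS; first by exists 0%N.
    have [|N hN] := IH; first by move=> y ys; apply: sS; rewrite inE ys orbT.
    have /asboolP[m mx] : x \in S by apply: sS; rewrite mem_head.
    exists (maxn N m.+1) => y; rewrite inE => /predU1P[->|/hN[m' m'N my]].
      by exists m => //; rewrite leq_max ltnSn orbT.
    by exists m' => //; rewrite leq_max m'N.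
  apply/cvg_ballP => e e0; near=> n.
  have [_ /(_ p)] := hpick (mkseq kap n); rewrite size_mkseq.
  rewrite -/(u n) => H; apply: le_ball (H _ _).
  - rewrite ltW //; near: n; exact: (near_infty_natSinv_lt (PosNum e0)).
  - by near: n; exact: nbhs_infty_ge.
  - move=> i; have [|m mN <-] := hN0 p`_i.
      have [ip|ip] := ltnP i (size p); last by rewrite nth_default ?mem_head.
      by rewrite inE mem_nth ?orbT.
    apply/mapP; exists m => //; rewrite mem_iota add0n /=.
    by apply: leq_trans mN _; near: n; exact: nbhs_infty_ge.
exists u; split=> [n|p]; first by have [] := hpick (mkseq kap n).
have [m [mu [q [fr qS pE]]]] := free_decomposition S p.
have minE (w : {poly k} -> \bar R) b : ultrametric w -> orthogonal_basis w b ->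
    (forall n, b n \is a polyOver S) ->
    w p = \big[Order.min/+oo%E]_(j < m) w (q j).
  move=> uw ob bS; apply/eqP; rewrite pE eq_le; apply/andP; split.
    apply: le_bigmin => [|j _]; first exact: leey.
    exact: (ultra_free_combination uw ob bS fr qS _).1.
  apply: (ultra_free_combination uw ob bS fr qS _).2 => j.
  exact: bigmin_le.
have -> : (fun n => u n p) = fun n => \big[Order.min/+oo%E]_(j < m) u n (q j).
  by apply/funext => n; have [Bn _] := hpick (mkseq kap n);
    exact: (minE _ _ (uB _ Bn) (obs _) (uS n)).
rewrite (minE a ba ua oba baS).
elim: (m) => [|i IH].
  rewrite big_ord0; under eq_fun do rewrite big_ord0; exact: cvg_cst.
rewrite big_ord_recr /=; under eq_fun do rewrite big_ord_recr /=.
exact: (cvg_comp2 IH (cvS _ (qS i)) (@min_continuous _ (\bar R) (_, _))).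
Unshelve. all: by end_near.
Qed.

(** * Algebras of countable dimension *)

Section Spanning.
Context (k : fieldType) (A : comPzRingType) (c : {rmorphism k -> A}).

Definition lincomb (e : nat -> A) (p : {poly k}) : A :=
  \sum_(i < size p) c p`_i * e i.

Definition spans (e : nat -> A) := forall a, exists p, a = lincomb e p.

Lemma lincombE e n (p : {poly k}) : (size p <= n)%N ->
  lincomb e p = \sum_(i < n) c p`_i * e i.
Proof.
move=> sp; rewrite /lincomb (big_ord_widen n (fun i => c p`_i * e i)) //.
rewrite big_mkcond /=; apply: eq_bigr => i _; case: ltnP => // ip.
by rewrite nth_default // rmorph0 mul0r.
Qed.

Lemma lincomb0 e : lincomb e 0 = 0.
Proof. by rewrite /lincomb size_poly0 big_ord0. Qed.

Lemma lincombD e p q : lincomb e (p + q) = lincomb e p + lincomb e q.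
Proof.
have [sp sq] := (leq_maxl (size p) (size q), leq_maxr (size p) (size q)).
rewrite (lincombE e (size_polyD p q)) (lincombE e sp) (lincombE e sq).
by rewrite -big_split; apply: eq_bigr => i _; rewrite coefD rmorphD mulrDl.
Qed.

Lemma lincombZ e a p : lincomb e (a *: p) = c a * lincomb e p.
Proof.
rewrite (lincombE e (size_scale_leq a p)) mulr_sumr; apply: eq_bigr => i _.
by rewrite coefZ rmorphM mulrA.
Qed.

Lemma lincombXn e n : lincomb e 'X^n = e n.
Proof.
rewrite /lincomb size_polyXn big_ord_recr big1 /= => [|i _].
  by rewrite coefXn eqxx rmorph1 mul1r add0r.
by rewrite coefXn ltn_eqF // rmorph0 mul0r.
Qed.

Lemma lincomb_ultrametric (R : realType) (v : A -> \bar R) e :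
  semivaluation c v -> ultrametric (v \o lincomb e).
Proof.
move=> sv; split=> [|p q|a p a0] /=.
- by rewrite lincomb0 (semival0 sv).
- by rewrite lincombD; exact: semivalD sv _ _.
- by rewrite lincombZ (semivalM sv) (semival_cst sv a0) add0e.
Qed.

Lemma semivaluation_sequence (R : realType) (e : nat -> A)
  (B : set (A -> \bar R)) (v : A -> \bar R) : spans e ->
  semivaluation c v -> (forall w, B w -> semivaluation c w) ->
  (forall (G : seq A) (eps : R), 0 < eps ->
    exists2 w, B w & forall g, g \in G -> ball (v g) eps (w g)) ->
  exists u : nat -> A -> \bar R,
    (forall n, B (u n)) /\ forall g, u n g @[n --> \oo] --> v g.
Proof.
move=> se sv sB clB.
have [||u [uB cu]] := @ultrametric_sequence k R
    [set w \o lincomb e | w in B] (v \o lincomb e) (lincomb_ultrametric e sv).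
- by move=> _ [w Bw <-]; apply: lincomb_ultrametric; exact: sB.
- move=> G eps eps0.
  have [w Bw hw] := clB [seq lincomb e p | p <- G] eps eps0.
  exists (w \o lincomb e); first by exists w.
  by move=> p pG; apply: hw; exact: map_f.
have /choice[u' hu'] : forall n, exists w, B w /\ w \o lincomb e = u n.
  by move=> n; have [w Bw wE] := uB n; exists w.
exists u'; split=> [n|g]; first by have [] := hu' n.
have [p ->] := se g.
have -> : (fun n => u' n (lincomb e p)) = fun n => u n p; last exact: cu.
by apply/funext => n; have [_ <-] := hu' n.
Qed.

Lemma in_spanD e (a b : A) : (exists p, a = lincomb e p) ->
  (exists p, b = lincomb e p) -> exists p, a + b = lincomb e p.
Proof. by move=> [p ->] [q ->]; exists (p + q); rewrite lincombD. Qed.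

Lemma in_span_sum e I (s : seq I) (F : I -> A) :
  (forall i, exists p, F i = lincomb e p) ->
  exists p, \sum_(i <- s) F i = lincomb e p.
Proof.
move=> hF; elim/big_ind: _ => [|a b|i _]; last exact: hF.
  by exists 0; rewrite lincomb0.
exact: in_spanD.
Qed.

(** The product of two words in the generators is a word, so that the linear
    combinations of words form a subalgebra. *)
Lemma fin_gen_spans : fin_gen_algebra c -> exists e, spans e.
Proof.
move=> [gen hgen].
pose word (s : seq nat) := \prod_(i <- s) gen`_i.
pose e n := if unpickle n is Some s then word s else 1.
have eP s : e (pickle s) = word s by rewrite /e pickleK.
exists e; apply: hgen.
- move=> l; exists (l *: 'X^(pickle ([::] : seq nat))).
  by rewrite lincombZ lincombXn eP /word big_nil mulr1.
- move=> a /(nthP 0)[i _ <-]; exists ('X^(pickle [:: i])).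
  by rewrite lincombXn eP /word big_seq1.
- by move=> a b; exact: in_spanD.
- move=> _ _ [p ->] [q ->]; rewrite /lincomb mulr_suml.
  apply: in_span_sum => i; rewrite mulr_sumr; apply: in_span_sum => j.
  have [s es] : exists s, e i = word s.
    by rewrite /e; case: unpickle => [s|]; [exists s|exists [::]; rewrite /word big_nil].
  have [t et] : exists s, e j = word s.
    by rewrite /e; case: unpickle => [r|]; [exists r|exists [::]; rewrite /word big_nil].
  exists ((p`_i * q`_j) *: 'X^(pickle (s ++ t))).
  rewrite lincombZ lincombXn eP /word big_cat -!/(word _) -es -et rmorphM.
  by rewrite mulrACA.
Qed.

End Spanning.

(** Gaussian elimination: choose for each [n], if possible, an element of the
    subspace [A] with leading term [e n]. Subtracting multiples of the chosen
    elements removes the leading terms of any element of [A] one by one. *)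
Lemma spans_sub (k : fieldType) (A B : comPzRingType)
  (cA : {rmorphism k -> A}) (cB : {rmorphism k -> B}) (r : {rmorphism A -> B})
  (e : nat -> B) : (forall l, r (cA l) = cB l) -> injective r ->
  spans cB e -> exists e', spans cA e'.
Proof.
move=> rc rI se.
pose leads n a := exists p : {poly k},
  [/\ p \is monic, size p = n.+1 & r a = lincomb cB e p].
have /choice[e' he'] : forall n, exists a, (exists b, leads n b) -> leads n a.
  move=> n; have [[b lb]|nb] := pselect (exists b, leads n b).
    by exists b.
  by exists 0 => /nb.
exists e' => a; have [p] := se (r a).
move: {2}(size p) (leqnn (size p)) => n.
elim: n p a => [|n IH] p a sp ra.
  have p0 : p = 0 by apply/eqP; rewrite -size_poly_leq0.
  by exists 0; apply: rI; rewrite ra p0 !lincomb0 rmorph0.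
have [c0|c0] := eqVneq p`_n 0.
  apply: (IH p a) => //; apply/leq_sizeP => j.
  rewrite leq_eqVlt => /predU1P[<- //|nj].
  by rewrite nth_default //; exact: leq_trans sp nj.
have sp' : size p = n.+1.
  apply/eqP; rewrite eqn_leq sp /= ltnNge.
  by apply: contra c0 => spn; rewrite nth_default.
have ld : leads n (cA (p`_n)^-1 * a).
  exists ((p`_n)^-1 *: p); split.
  - by rewrite monicE lead_coefZ lead_coefE sp' mulVf.
  - by rewrite size_scale // invr_eq0.
  - by rewrite rmorphM rc ra lincombZ.
have [|q [qm sq rq]] := he' n; first by eexists; exact: ld.
have [||p' p'E] := IH (p - p`_n *: q) (a - cA p`_n * e' n).
- apply/leq_sizeP => j; rewrite leq_eqVlt coefB coefZ => /predU1P[<-|nj].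
    by move/monicP: qm; rewrite lead_coefE sq /= => ->; rewrite mulr1 subrr.
  rewrite [p`_j]nth_default ?[q`_j]nth_default ?mulr0 ?subrr ?sq //.
  exact: leq_trans sp nj.
- by rewrite rmorphB rmorphM rc ra rq -scaleNr lincombD lincombZ rmorphN mulNr.
exists (p`_n *: 'X^n + p').
by rewrite lincombD lincombZ lincombXn -p'E addrC subrK.
Qed.

Lemma spans_loc (k : fieldType) (A B : comPzRingType) (cA : {rmorphism k -> A})
  (cB : {rmorphism k -> B}) (g : {rmorphism A -> B}) (f : A) :
  (forall l, g (cA l) = cB l) -> is_localization g f ->
  (exists e, spans cA e) -> exists e, spans cB e.
Proof.
move=> gc [[h hE] frac _] [e se].
pose e' n := if unpickle n is Some (i, m) then g (e i) * h ^+ m else 0.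
have e'P i m : e' (pickle (i, m)) = g (e i) * h ^+ m by rewrite /e' pickleK.
exists e' => b; have [a [m bE]] := frac b.
have -> : b = g a * h ^+ m by rewrite -bE -mulrA -exprMn hE expr1n mulr1.
have [p ->] := se a; rewrite rmorph_sum mulr_suml; apply: in_span_sum => i.
exists (p`_i *: 'X^(pickle (i : nat, m))).
by rewrite lincombZ lincombXn e'P rmorphM gc mulrA.
Qed.

(** * Affine opens *)

Definition opensI (T : topologicalType) (U V : opens T) : opens T :=
  Opens (openI (oset_open U) (oset_open V)).

Lemma prime_idealX (A : comPzRingType) (p : set A) a n :
  prime_ideal p -> p (a ^+ n) -> p a.
Proof.
move=> pp; elim: n => [|n IH]; first by rewrite expr0 => /(prime_ideal1 pp).
by rewrite exprS => /(prime_idealM pp)[].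
Qed.

Lemma prime_idealMr (A : comPzRingType) (p : set A) a b :
  prime_ideal p -> p a -> p (a * b).
Proof. by move=> pp pa; rewrite mulrC; exact: prime_idealMl. Qed.

Lemma prime_ideal_preimage (A B : comPzRingType) (g : {rmorphism A -> B})
  (p : set B) : prime_ideal p -> prime_ideal (g @^-1` p).
Proof.
move=> pp; split=> /=.
- by rewrite rmorph0; exact: prime_ideal0.
- by move=> a b; rewrite rmorphD; exact: prime_idealD.
- by move=> a b; rewrite rmorphM; exact: prime_idealMl.
- by rewrite rmorph1; exact: prime_ideal1.
- by move=> a b; rewrite rmorphM; exact: prime_idealM.
Qed.

Lemma invertible_morph (A B : comPzRingType) (g : {rmorphism A -> B}) a :
  invertible a -> invertible (g a).
Proof. by move=> [b ab]; exists (g b); rewrite -rmorphM ab rmorph1. Qed.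

Lemma invertibleM (A : comPzRingType) (a b : A) :
  invertible (a * b) <-> invertible a /\ invertible b.
Proof.
split=> [[c abc]|[[c ac] [d bd]]]; last first.
  by exists (c * d); rewrite mulrACA ac bd mulr1.
by split; [exists (b * c)|exists (a * c)]; rewrite -abc ?mulrA // [b * a]mulrC.
Qed.

Lemma invertibleX (A : comPzRingType) (a : A) n :
  invertible a -> invertible (a ^+ n).
Proof.
move=> [b ab]; exists (b ^+ n); by rewrite -exprMn ab expr1n.
Qed.

Lemma invertible_inj (A : comPzRingType) (a b c : A) :
  invertible a -> a * b = a * c -> b = c.
Proof.
move=> [d ad] abc.
by rewrite -[b]mul1r -[c]mul1r -ad [a * d]mulrC -!mulrA abc.
Qed.

Section InvertibleAt.
Context (X : ringed_space).

Lemma invertible_at_res (U W : opens X) (h : W `<=` U) (s : sect U) (x : X) :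
  W x -> invertible_at (res h s) x <-> invertible_at s x.
Proof.
move=> Wx; split=> [[V [hV [Vx]]]|[V [hV [Vx iV]]]].
  have hVU : V `<=` U by move=> y /hV/h.
  by rewrite (res_comp h hV hVU) => iV; exists V, hVU.
have hI : opensI V W `<=` W by move=> y [].
have hIV : opensI V W `<=` V by move=> y [].
have hIU : opensI V W `<=` U by move=> y /hIV/hV.
exists (opensI V W), hI; split=> //.
by rewrite (res_comp h hI hIU) -(res_comp hV hIV hIU); exact: invertible_morph.
Qed.

Lemma invertible_atM (U : opens X) (s t : sect U) (x : X) :
  invertible_at (s * t) x <-> invertible_at s x /\ invertible_at t x.
Proof.
split=> [[W [h [Wx]]]|[[W [h [Wx iW]]] [V [hV [Vx iV]]]]].
  by rewrite rmorphM => /invertibleM[? ?]; split; exists W, h.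
have hIW : opensI W V `<=` W by move=> y [].
have hIV : opensI W V `<=` V by move=> y [].
have hI : opensI W V `<=` U by move=> y /hIW/h.
exists (opensI W V), hI; split=> //; rewrite rmorphM; apply/invertibleM.
rewrite -{1}(res_comp h hIW hI) -(res_comp hV hIV hI).
by split; exact: invertible_morph.
Qed.

Lemma invertible_atX (U : opens X) (s : sect U) n (x : X) :
  invertible_at s x -> invertible_at (s ^+ n) x.
Proof.
move=> [W [h [Wx iW]]]; exists W, h; split=> //.
by rewrite rmorphXn; exact: invertibleX.
Qed.

Lemma invertible_at1 (U : opens X) (x : X) :
  U x -> invertible_at (1 : sect U) x.
Proof.
move=> Ux; exists U, (@subset_refl _ _); split=> //.
by exists 1; rewrite mulr1 rmorph1.
Qed.

End InvertibleAt.

Section Affine.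
Context (X : ringed_space) (U : opens X) (phi : X -> set (sect U)).
Hypothesis hphi : is_spec_iso phi.

Lemma basic_open_subproof (f : sect U) : open [set x : X | U x /\ ~ phi x f].
Proof.
apply/(spec_homeo hphi); first by move=> x [].
by move=> x [_ fx]; exists f; split.
Qed.

Definition basic_open (f : sect U) : opens X := Opens (basic_open_subproof f).

Lemma basic_open_sub f : basic_open f `<=` U. Proof. by move=> x []. Qed.

Lemma basic_open_loc f : is_localization (res (@basic_open_sub f)) f.
Proof. by apply: (spec_sheaf hphi) => x. Qed.

Lemma basic_open_basis (V : opens X) x : U x -> V x ->
  exists f, ~ phi x f /\ basic_open f `<=` V.
Proof.
move=> Ux Vx; have /(spec_homeo hphi) : open (opensI U V) by exact: oset_open.
have hI : opensI U V `<=` U by move=> y [].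
move=> /(_ hI x (conj Ux Vx))[f [fx hf]]; exists f; split=> // y [Uy fy].
by have [] := hf y Uy fy.
Qed.

Lemma section_fraction (V : opens X) (s : sect V) x : U x -> V x ->
  exists (h r : sect U) (W : opens X) (hU : W `<=` U) (hV : W `<=` V),
    [/\ W x, invertible (res hU h) & res hV s * res hU h = res hU r].
Proof.
move=> Ux Vx; have [f [fx hf]] := basic_open_basis Ux Vx.
have [fu ff _] := basic_open_loc f.
have [r [n rE]] := ff (res hf s).
exists (f ^+ n), r, (basic_open f), (@basic_open_sub f), hf.
by rewrite rmorphXn rE; split=> //; exact: invertibleX.
Qed.

(** Thus the prime ideal at a point of an affine open does not depend on the
    choice of [phi], and it is compatible with restriction to smaller affine
    opens. *)
Lemma spec_pointE x s : U x -> phi x s <-> ~ invertible_at s x.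
Proof.
move=> Ux; have pp := spec_prime hphi Ux; split=> [ps [W [hW [Wx iW]]]|]; last first.
  apply: contra_notP => sx; exists (basic_open s), (@basic_open_sub s).
  by split=> //; exact: loc_unit (basic_open_loc s).
have [f [fx hf]] := basic_open_basis Ux Wx.
have [fu ff fk] := basic_open_loc f.
have [t st] : invertible (res (@basic_open_sub f) s).
  by rewrite -(res_comp hW hf (@basic_open_sub f)); exact: invertible_morph.
have [r [n rE]] := ff t.
have [|m mE] := fk (s * r - f ^+ n).
  by rewrite rmorphB rmorphM -rE mulrA st mul1r rmorphXn subrr.
apply: fx; apply: (@prime_idealX _ _ f (m + n)) => //.
move/eqP: mE; rewrite mulrBr subr_eq0 -exprD => /eqP <-.
by apply: prime_idealMl => //; exact: prime_idealMr.
Qed.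

Lemma spec_point_notE x s : U x -> ~ phi x s <-> invertible_at s x.
Proof. by move=> Ux; rewrite spec_pointE // not_notE. Qed.

(** The points are the primes [p] of the ring [A] of sections over [U] that do
    not contain [f], and the prime of [A[1/f]] above [p] consists of the sections
    that are not invertible at the point [p]. *)
Lemma basic_open_affine f : affine (basic_open f).
Proof.
set W := basic_open f; pose hW : W `<=` U := @basic_open_sub f.
pose psi (x : X) : set (sect W) := [set s | ~ invertible_at s x].
have [fu ff fk] : is_localization (res hW) f := basic_open_loc f.
have psiE x (s : sect W) r n : W x -> s * res hW f ^+ n = res hW r ->
    psi x s <-> phi x r.
  move=> Wx sr; have [Ux fx] := Wx.
  rewrite spec_pointE // /psi /= -(invertible_at_res hW r Wx) -sr.
  rewrite invertible_atM; split; first by move=> si [].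
  move=> nsi si; apply: nsi; split=> //; apply: invertible_atX.
  by apply/invertible_at_res => //; apply/spec_point_notE.
exists psi; split.
- move=> x Wx; have [Ux fx] := Wx; have pp := spec_prime hphi Ux.
  have psi0 : psi x 0.
    apply/(@psiE _ _ 0 0) => //; first by rewrite mul0r rmorph0.
    exact: prime_ideal0 pp.
  split=> //.
  + move=> a b; have [ra [n aE]] := ff a; have [rb [m bE]] := ff b.
    rewrite (psiE _ _ _ _ Wx aE) (psiE _ _ _ _ Wx bE) => pa pb.
    apply/(@psiE _ _ (ra * f ^+ m + rb * f ^+ n) (n + m)) => //.
      rewrite rmorphD !rmorphM -aE -bE !rmorphXn mulrDl -!mulrA -!exprD.
      by rewrite [(m + n)%N]addnC.
    by apply: (prime_idealD pp); exact: prime_idealMr.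
  + by move=> a b nb /invertible_atM[].
  + by move=> n1; apply: n1; exact: invertible_at1.
  + move=> a b nab; have [ia|na] := pselect (invertible_at a x); last by left.
    by right => ib; apply: nab; apply/invertible_atM.
- move=> x y Wx Wy xy; have [[Ux _] [Uy _]] := (Wx, Wy).
  apply: (spec_inj hphi Ux Uy); apply/seteqP.
  have H z r : W z -> phi z r <-> psi z (res hW r).
    by move=> Wz; apply: iff_sym; apply: (@psiE _ _ _ 0) => //; rewrite mulr1.
  by split=> r; rewrite !H // xy.
- move=> p pp; have [x Ux xE] := spec_surj hphi (prime_ideal_preimage (res hW) pp).
  have Wx : W x.
    split=> //; rewrite xE => pf; have [g fg] := fu.
    by apply: (prime_ideal1 pp); rewrite -fg; exact: prime_idealMr.
  exists x => //; apply/seteqP; split=> s; have [r [n sr]] := ff s.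
    rewrite (psiE _ _ _ _ Wx sr) xE /= -sr => /(prime_idealM pp)[//|/prime_idealX].
    move=> /(_ pp) pf; have [g fg] := fu.
    by case: (prime_ideal1 pp); rewrite -fg; exact: prime_idealMr.
  by move=> ps; rewrite (psiE _ _ _ _ Wx sr) xE /= -sr; exact: prime_idealMr.
- move=> W' W'W; have W'U : W' `<=` U by move=> x /W'W[].
  rewrite (spec_homeo hphi W'U); split=> H x W'x.
    have [Ux fx] := W'W _ W'x.
    have [g [gx hg]] := H x W'x; exists (res hW g).
    have E z : W z -> psi z (res hW g) <-> phi z g.
      by move=> Wz; apply: (@psiE _ _ _ 0) => //; rewrite mulr1.
    rewrite E //; split=> // y Wy; rewrite E //; apply: hg; by case: Wy.
  have [Ux fx] := W'W _ W'x; have pp := spec_prime hphi Ux.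
  have [s [sx hs]] := H x W'x; have [r [n sr]] := ff s.
  exists (r * f); split.
    by move=> /(prime_idealM pp)[|//]; rewrite -(psiE _ _ _ _ _ sr) //; exact: W'W.
  move=> y Uy rfy; have ppy := spec_prime hphi Uy.
  have Wy : W y.
    by split=> // fy; apply: rfy; exact: prime_idealMl.
  by apply: hs => //; rewrite (psiE _ _ _ _ Wy sr) => ry; apply: rfy; exact: prime_idealMr.
- move=> s W' h' W'E; have [r [n sr]] := ff s.
  have W'U : W' `<=` U by move=> x /h'/hW.
  have rc (t : sect U) : res h' (res hW t) = res W'U t by exact: res_comp.
  have [rfu rff rfk] : is_localization (res W'U) (r * f).
    apply: (spec_sheaf hphi) => x; rewrite W'E; split.
      move=> [Wx]; rewrite (psiE _ _ _ _ Wx sr); have [Ux fx] := Wx => rx.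
      by split=> // /(prime_idealM (spec_prime hphi Ux))[].
    move=> [Ux rfx]; have pp := spec_prime hphi Ux.
    have Wx : W x by split=> // fx; apply: rfx; exact: prime_idealMl.
    by split=> //; rewrite (psiE _ _ _ _ Wx sr) => rx; apply: rfx; exact: prime_idealMr.
  have [g fg] := fu.
  have srW : res W'U r = res h' s * res W'U f ^+ n.
    by rewrite -!rc -sr rmorphM rmorphXn.
  have fgW : res W'U f * res h' g = 1 by rewrite -rc -rmorphM fg rmorph1.
  split.
  + have : invertible (res W'U r * res W'U f) by rewrite -rmorphM.
    by rewrite srW => /invertibleM[/invertibleM[]].
  + move=> b; have [a [m abE]] := rff b.
    exists (res hW a * g ^+ (n * m + m)), m.
    rewrite rmorphM rc -abE rmorphM srW !exprMn -exprM rmorphXn.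
    rewrite -[_ * _ ^+ (n * m) * _]mulrA -exprD -!mulrA -exprMn fgW expr1n.
    by rewrite mulr1.
  + move=> a a0; have [b [l bE]] := ff a.
    have [m mE] : exists m, (r * f) ^+ m * b = 0.
      by apply: rfk; rewrite -rc -bE rmorphM a0 mul0r.
    exists m; move/(congr1 (res hW)): mE.
    rewrite rmorph0 rmorphM -bE rmorphXn rmorphM -sr => E.
    apply: (@invertible_inj _ (res hW f ^+ ((n.+1) * m + l))).
      exact: invertibleX.
    rewrite mulr0 -E exprD exprM exprSr -[_ * _ * res hW f]mulrA.
    by rewrite [LHS]mulrC mulrACA !exprMn.
Qed.

End Affine.

(** * The function field of an integral scheme *)

(** The function field is presented through the embeddings of the rings of
    sections over all nonempty open sets, which are the neighborhoods of the
    generic point; [ff_unit] says that the local ring at this point is a field. *)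
Record function_field (X : scheme) := FunctionField {
  ff_point : X;
  ff_field : fieldType;
  ff_map : forall V : opens X, V ff_point -> {rmorphism sect V -> ff_field};
  ff_generic : forall (V : opens X) (x : X), V x -> V ff_point;
  ff_inj : forall (V : opens X) (hV : V ff_point), injective (ff_map hV);
  ff_res : forall (U V : opens X) (hU : U ff_point) (hV : V ff_point)
    (h : V `<=` U) (s : sect U), ff_map hV (res h s) = ff_map hU s;
  ff_unit : forall (V : opens X) (hV : V ff_point) (s : sect V),
    ff_map hV s != 0 -> invertible_at s ff_point }.

Arguments ff_point {X} f.
Arguments ff_field {X} f.
Arguments ff_map {X} f {V} hV.
Arguments ff_inj {X f V} hV [x1 x2] _.
Arguments ff_res {X f U V} hU hV h s.
Arguments ff_unit {X f V} hV s _.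
Arguments ff_generic {X} f {V x} _.

Section Sheaf.
Context (X : scheme).

Lemma sheaf_eq0 (V : opens X) (s : sect V) :
  (forall x, V x -> exists (W : opens X) (h : W `<=` V), W x /\ res h s = 0) ->
  s = 0.
Proof.
move=> hs.
pose I := {W : opens X & {h : W `<=` V | res h s = 0}}.
pose U (i : I) : opens X := projT1 i.
pose hU (i : I) : U i `<=` V := sval (projT2 i).
have [|i j W hi hj|t [_ tU]] :=
    @scheme_sheaf X I V U hU (fun i => (0 : sect (U i))).
- move=> x /hs[W [h [Wx s0]]].
  by exists (existT _ W (exist _ h s0)).
- by rewrite !rmorph0.
rewrite -[LHS]tU; first by apply: tU => i; rewrite rmorph0.
by move=> [W [h s0]].
Qed.

Lemma sect_empty (V : opens X) (s : sect V) : (forall x, ~ V x) -> s = 0.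
Proof. by move=> V0; apply: sheaf_eq0 => x /V0. Qed.

Hypothesis irrX : irreducible_space X.
Hypothesis redX : reduced X.

Section AffineDomain.
Context (U : opens X) (phi : X -> set (sect U)).
Hypothesis hphi : is_spec_iso phi.

(** If [f] vanishes at all points, the basic open set of [f] is empty. The ring
    of sections over it is zero and is the localization at [f], so that [f] is
    nilpotent. *)
Lemma affine_eq0 (f : sect U) : (forall x, U x -> phi x f) -> f = 0.
Proof.
move=> f0; have [_ _ fk] := basic_open_loc hphi f.
have [|n] := fk 1; last by rewrite mulr1 => /redX.
by apply: sect_empty => x [Ux]; apply; exact: f0.
Qed.

(** Otherwise the basic open sets of [a] and [b] would be nonempty and
    disjoint. *)
Lemma affine_domain (a b : sect U) : a * b = 0 -> a = 0 \/ b = 0.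
Proof.
move=> ab; apply: contrapT => /not_orP[a0 b0].
have ne f : f <> 0 -> basic_open hphi f !=set0.
  move=> f0; apply: contrapT => n0; apply: f0; apply: affine_eq0 => x Ux.
  by apply: contrapT => fx; apply: n0; exists x.
have [x [[Ux ax] [_ bx]]] := irrX.2 _ _ (ne _ a0) (ne _ b0).
have pp := spec_prime hphi Ux.
have : phi x (a * b) by rewrite ab; exact: prime_ideal0.
by move=> /(prime_idealM pp)[].
Qed.

Lemma affine_zero_prime : U !=set0 -> prime_ideal [set 0 : sect U].
Proof.
move=> [x Ux]; have pp := spec_prime hphi Ux; split=> //=.
- by move=> a b -> ->; rewrite addr0.
- by move=> a b ->; rewrite mulr0.
- by move=> /= e1; apply: (prime_ideal1 pp); rewrite e1; exact: prime_ideal0.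
- exact: affine_domain.
Qed.

End AffineDomain.

Lemma generic_point_exists : exists x0 : X,
  (forall (V : opens X) x, V x -> V x0) /\
  exists (U : opens X) (phi : X -> set (sect U)),
    [/\ is_spec_iso phi, U x0 & phi x0 = [set 0]].
Proof.
have [[x1 _] irr] := irrX.
have [U [Ux1 [phi hphi]]] := scheme_affine x1.
have U0 : U !=set0 by exists x1.
have [x0 Ux0 x0E] := spec_surj hphi (affine_zero_prime hphi U0).
exists x0; split; last by exists U, phi.
move=> V x Vx; have V0 : V !=set0 by exists x.
have [y [Uy Vy]] := irr U V U0 V0.
have [f [fy hf]] := basic_open_basis hphi Uy Vy.
apply: hf; split=> //; rewrite x0E /= => f0; apply: fy; rewrite f0.
exact: prime_ideal0 (spec_prime hphi Uy).
Qed.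

Lemma res_eq0 (U W : opens X) (h : W `<=` U) (s : sect U) :
  affine U -> W !=set0 -> res h s = 0 -> s = 0.
Proof.
move=> [phi hphi] [x Wx] s0; have Ux := h x Wx.
have [f [fx hf]] := basic_open_basis hphi Ux Wx.
have [_ _ fk] := basic_open_loc hphi f.
have [|n] := fk s; first by rewrite -(res_comp h hf) s0 rmorph0.
move=> /(affine_domain hphi)[/redX f0|//]; case: fx; rewrite f0.
exact: prime_ideal0 (spec_prime hphi Ux).
Qed.

Lemma function_field_exists : normal_scheme X -> inhabited (function_field X).
Proof.
move=> nX; have [x0 [gen [U0 [phi0 [hphi0 Ux0 x0E]]]]] := generic_point_exists.
have [S [germ [[gres _ ginj] _]]] := nX x0.
pose K : fieldType := {fraction S}.
pose gam (V : opens X) (hV : V x0) : {rmorphism sect V -> K} :=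
  (@FracField.tofrac S) \o germ V hV.
suff gI (V : opens X) (hV : V x0) : injective (gam V hV).
  have gr (U V : opens X) (hU : U x0) (hV : V x0) (h : V `<=` U) (s : sect U) :
    gam V hV (res h s) = gam U hU s by rewrite /= (gres _ _ hU).
  have gu (V : opens X) (hV : V x0) (s : sect V) :
      gam V hV s != 0 -> invertible_at s x0.
    move=> gs0; have [h [r [W [hU [hW [Wx ih E]]]]]] :=
      section_fraction hphi0 s Ux0 hV.
    have /(spec_point_notE hphi0 _ Ux0)/(invertible_at_res hU r Wx) : ~ phi0 x0 r.
      rewrite x0E => r0; move/negP: gs0; apply; apply/eqP.
      have s0 : res hW s = 0.
        by apply: (invertible_inj ih); rewrite mulr0 mulrC E r0 rmorph0.
      by rewrite -(gr _ _ hV Wx hW) s0 rmorph0.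
    by rewrite -E => /invertible_atM[/(invertible_at_res hW s Wx)].
  by constructor; exact: (FunctionField gen gI gr gu).
apply: raddf_inj => s /eqP; rewrite /= tofrac_eq0 => /eqP s0.
have [|W [hW [Wx0]]] := ginj V hV s 0; first by rewrite s0 rmorph0.
rewrite rmorph0 => sW; apply: sheaf_eq0 => x Vx.
have [U [Ux aU]] := scheme_affine x; have [phi hphi] := aU.
have [h [r [N [hU [hN [Nx ih sh]]]]]] := section_fraction hphi s Ux Vx.
exists N, hN; split=> //.
suff r0 : r = 0.
  apply: (invertible_inj ih); rewrite mulr0 mulrC sh r0; exact: rmorph0.
pose M := opensI N W.
have MN : M `<=` N by move=> y [].
have MW : M `<=` W by move=> y [].
have MU : M `<=` U by move=> y /MN/hU.
have MV : M `<=` V by move=> y /MN/hN.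
have M0 : M !=set0 by exists x0; split=> //; exact: gen Nx.
apply: (@res_eq0 _ _ MU _ aU M0).
rewrite -(res_comp hU MN MU) -sh rmorphM (res_comp hN MN MV).
by rewrite -(res_comp hW MW MV) sW rmorph0 mul0r.
Qed.

End Sheaf.

(** * The spectrum of a domain *)

(** An ideal that is maximal among those that contain [I] and no power of [f]
    is prime. *)
Lemma prime_ideal_avoiding (A : comPzRingType) (I : set A) (f : A) :
  I 0 -> (forall a b, I a -> I b -> I (a + b)) ->
  (forall a b, I b -> I (a * b)) -> (forall n, ~ I (f ^+ n)) ->
  exists p, [/\ prime_ideal p, I `<=` p & ~ p f].
Proof.
move=> I0 ID IM If.
(* The union with [I] lets the empty chain have an upper bound. *)
pose ok (J : set A) := [/\ forall a b, J a -> J b -> J (a + b),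
  forall a b, J b -> J (a * b) & forall n, ~ J (f ^+ n)].
have [|M [[MD MM Mf] maxM]] := @Zorn_bigcup A [set J | ok (J `|` I)].
  move=> F Fok tot.
  have both a b : (\bigcup_(J in F) J `|` I) a -> (\bigcup_(J in F) J `|` I) b ->
      (I a /\ I b) \/ exists2 J, F J & (J `|` I) a /\ (J `|` I) b.
    move=> [[J FJ Ja]|Ia] [[J' FJ' J'b]|Ib]; last by left.
    - have [JJ'|J'J] := tot _ _ FJ FJ'; right.
        by exists J' => //; split; left => //; exact: JJ'.
      by exists J => //; split; left => //; exact: J'J.
    - by right; exists J => //; split; [left|right].
    - by right; exists J' => //; split; [right|left].
  have sub J : F J -> J `|` I `<=` \bigcup_(J in F) J `|` I.
    by move=> FJ a [Ja|]; [left; exists J|right].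
  split.
  - move=> a b ha hb; have [[Ia Ib]|[J FJ [Ja Jb]]] := both _ _ ha hb.
      by right; exact: ID.
    by apply: (sub J FJ); have [D _ _] := Fok _ FJ; exact: D.
  - move=> a b hb; have [[Ib _]|[J FJ [Jb _]]] := both _ _ hb hb.
      by right; exact: IM.
    by apply: (sub J FJ); have [_ D _] := Fok _ FJ; exact: D.
  - move=> n hn; have [[Ib _]|[J FJ [Jb _]]] := both _ _ hn hn.
      exact: If Ib.
    by have [_ _ D] := Fok _ FJ; exact: D Jb.
pose J := M `|` I.
have J0 : J 0 by right.
have step a : ~ J a -> exists n b c, J b /\ f ^+ n = b + c * a.
  move=> Ja; pose B := [set x | exists b c, J b /\ x = b + c * a].
  have JB : J `<=` B by move=> x Jx; exists x, 0; rewrite mul0r addr0.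
  have Ba : B a by exists 0, 1; rewrite mul1r add0r.
  apply: contrapT => nf; apply: (maxM B).
    split=> [x Mx|BM]; first by apply: JB; left.
    by apply: Ja; left; exact: BM.
  have BI : B `|` I = B by apply/setUidPl => x Ix; apply: JB; right.
  rewrite /= BI; split.
  - move=> _ _ [b [c [Jb ->]]] [b' [c' [Jb' ->]]].
    by exists (b + b'), (c + c'); split; [exact: MD|rewrite mulrDl addrACA].
  - move=> x _ [b [c [Jb ->]]].
    by exists (x * b), (x * c); split; [exact: MM|rewrite mulrDr mulrA].
  - by move=> n [b [c [Jb fE]]]; apply: nf; exists n, b, c.
exists J; split=> [|x Ix|Jf]; [split=> //|by right|by apply: (Mf 1%N)].
- exact: Mf 0%N.
- move=> a b Jab; apply: contrapT => /not_orP[/step[n [u [c [Ju fn]]]]].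
  move=> /step[m [v [d [Jv fm]]]]; apply: (Mf (n + m)%N).
  rewrite exprD fn fm mulrDl; apply: (MD); first by rewrite mulrC; exact: MM.
  rewrite mulrDr; apply: (MD); first exact: MM.
  by rewrite mulrACA; exact: MM.
Qed.

Record prime_point (G : comPzRingType) := PrimePoint {
  pset : set G;
  pprime : prime_ideal pset }.

Section PrimePoints.
Context (G : comPzRingType).
Local Notation T := (prime_point G).

HB.instance Definition _ := gen_eqMixin T.
HB.instance Definition _ := gen_choiceMixin T.

Lemma prime_point_inj (p q : T) : pset p = pset q -> p = q.
Proof.
case: p q => [p pp] [q qq] /= pq; rewrite pq in pp *.
by congr PrimePoint; exact: Prop_irrelevance.
Qed.

Definition zariski_open : set_system T :=
  [set V | forall p, V p -> exists f, ~ pset p f /\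
     forall q, ~ pset q f -> V q].

Lemma zariski_openT : zariski_open setT.
Proof. by move=> p _; exists 1; split=> //; exact: prime_ideal1 (pprime p). Qed.

Lemma zariski_openI : setI_closed zariski_open.
Proof.
move=> V W oV oW p [/oV[f [fp hf]] /oW[g [gp hg]]].
exists (f * g); split; first by move=> /(prime_idealM (pprime p))[].
move=> q fg; split; [apply: hf|apply: hg] => h; apply: fg.
  exact: prime_idealMr (pprime q) h.
exact: prime_idealMl (pprime q) _ _ h.
Qed.

Lemma zariski_open_bigU (I : Type) (F : I -> set T) :
  (forall i, zariski_open (F i)) -> zariski_open (\bigcup_i F i).
Proof.
move=> oF p [i _ /oF[f [fp hf]]]; exists f; split=> // q /hf ?; by exists i.
Qed.

HB.instance Definition _ := isOpenTopological.Build T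
  zariski_openT zariski_openI zariski_open_bigU.

Lemma zariski_openE (V : set T) : open V = zariski_open V.
Proof. by []. Qed.

End PrimePoints.

Section Spec.
Context (G : comPzRingType) (K : fieldType) (gam : {rmorphism G -> K}).
Local Notation T := (prime_point G).

(** As the space is irreducible, the sections over a nonempty [V] are the
    elements of [K] that are fractions with a denominator outside [p] for each
    [p] in [V]. Constant functions on [V] encode them in such a way that
    there is only one section over the empty set. *)
Definition regular_at (p : T) (z : K) :=
  exists a b, ~ pset p b /\ z * gam b = gam a.

Definition regular (V : opens T) : {pred {p : T | V p} -> K} :=
  [pred s | `[< (forall p q, s p = s q) /\ forall p, regular_at (sval p) (s p) >]].

Lemma regularP (V : opens T) (s : {p : T | V p} -> K) :
  reflect ((forall p q, s p = s q) /\ forall p, regular_at (sval p) (s p))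
    (s \in @regular V).
Proof. exact: asboolP. Qed.

Lemma regular_subring (V : opens T) : subring_closed (@regular V).
Proof.
split.
- apply/regularP; split=> // p; exists 1, 1; rewrite rmorph1 mul1r.
  by split=> //; exact: prime_ideal1 (pprime _).
- move=> s t /regularP[sc sr] /regularP[tc tr]; apply/regularP; split.
    by move=> p q /=; congr (_ - _).
  move=> p; have [a [b [pb ab]]] := sr p; have [c [d [pd cd]]] := tr p.
  exists (a * d - c * b), (b * d); split.
    by move=> /(prime_idealM (pprime _))[].
  rewrite rmorphB !rmorphM -ab -cd mulrBl mulrA.
  by congr (_ - _); rewrite [gam b * _]mulrC mulrA.
- move=> s t /regularP[sc sr] /regularP[tc tr]; apply/regularP; split.
    by move=> p q /=; congr (_ * _).
  move=> p; have [a [b [pb ab]]] := sr p; have [c [d [pd cd]]] := tr p.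
  exists (a * c), (b * d); split; first by move=> /(prime_idealM (pprime _))[].
  by rewrite !rmorphM -ab -cd mulrACA.
Qed.

Record spec_sect (V : opens T) := SpecSect {
  sect_fun :> {p : T | V p} -> K;
  sect_funP : sect_fun \in @regular V }.

HB.instance Definition _ (V : opens T) := [isSub for @sect_fun V].
HB.instance Definition _ (V : opens T) := [Choice of spec_sect V by <:].
HB.instance Definition _ (V : opens T) :=
  GRing.SubChoice_isSubComPzRing.Build _ (@regular V) (spec_sect V)
    (@regular_subring V).

Definition spec_incl (V W : opens T) (h : W `<=` V) (p : {p : T | W p}) :
  {p : T | V p} := exist V (sval p) (h _ (proj2_sig p)).

Lemma spec_res_subproof (V W : opens T) (h : W `<=` V) (s : spec_sect V) :
  (fun p => s (spec_incl h p)) \in @regular W.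
Proof.
have /regularP[sc sr] := sect_funP s; apply/regularP; split=> // p.
exact: sr (spec_incl h p).
Qed.

Definition spec_res (V W : opens T) (h : W `<=` V) (s : spec_sect V) :=
  SpecSect (spec_res_subproof h s).

Lemma spec_sect_eq (V : opens T) (s t : spec_sect V) :
  (forall p, s p = t p) -> s = t.
Proof. by move=> st; apply: val_inj; apply/funext => p; exact: st. Qed.

Lemma spec_funX (V : opens T) (s : spec_sect V) n p : (s ^+ n) p = s p ^+ n.
Proof.
elim: n => [|n IH]; first by rewrite !expr0.
by rewrite !exprS -IH.
Qed.

Definition spec_eval (V : opens T) (p : {p : T | V p}) (s : spec_sect V) : K :=
  s p.

Lemma spec_eval_zmod (V : opens T) (p : {p : T | V p}) :
  zmod_morphism (spec_eval p).
Proof. by []. Qed.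

Lemma spec_eval_monoid (V : opens T) (p : {p : T | V p}) :
  monoid_morphism (spec_eval p).
Proof. by []. Qed.

HB.instance Definition _ (V : opens T) (p : {p : T | V p}) :=
  GRing.isZmodMorphism.Build _ _ (spec_eval p) (spec_eval_zmod p).
HB.instance Definition _ (V : opens T) (p : {p : T | V p}) :=
  GRing.isMonoidMorphism.Build _ _ (spec_eval p) (spec_eval_monoid p).

Lemma spec_res_zmod (V W : opens T) (h : W `<=` V) : zmod_morphism (spec_res h).
Proof. by move=> s t; exact: spec_sect_eq. Qed.

Lemma spec_res_monoid (V W : opens T) (h : W `<=` V) :
  monoid_morphism (spec_res h).
Proof. by split=> [|s t]; exact: spec_sect_eq. Qed.

HB.instance Definition _ (V W : opens T) (h : W `<=` V) :=
  GRing.isZmodMorphism.Build _ _ (spec_res h) (spec_res_zmod h).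
HB.instance Definition _ (V W : opens T) (h : W `<=` V) :=
  GRing.isMonoidMorphism.Build _ _ (spec_res h) (spec_res_monoid h).

Lemma spec_res_id (V : opens T) (h : V `<=` V) (s : spec_sect V) :
  spec_res h s = s.
Proof.
apply: spec_sect_eq => p /=; have /regularP[sc _] := sect_funP s; exact: sc.
Qed.

Lemma spec_res_comp (U V W : opens T) (hVU : V `<=` U) (hWV : W `<=` V)
  (hWU : W `<=` U) (s : spec_sect U) :
  spec_res hWV (spec_res hVU s) = spec_res hWU s.
Proof.
apply: spec_sect_eq => p /=; have /regularP[sc _] := sect_funP s; exact: sc.
Qed.

Definition spec_ringed : ringed_space :=
  @RingedSpace T (fun V => spec_sect V : comPzRingType)
    (fun V W h => spec_res h) spec_res_id spec_res_comp.

Hypothesis gamI : injective gam.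

Lemma zero_prime : prime_ideal [set 0 : G].
Proof.
split=> //=.
- by move=> a b -> ->; rewrite addr0.
- by move=> a b ->; rewrite mulr0.
- by move/(congr1 gam)/eqP; rewrite rmorph1 rmorph0 oner_eq0.
- move=> a b /(congr1 gam)/eqP; rewrite rmorphM rmorph0 mulf_eq0.
  by rewrite -!(rmorph0 gam) !(inj_eq gamI) => /orP[] /eqP; [left|right].
Qed.

Definition spec_generic : T := PrimePoint zero_prime.

Lemma spec_generic_in (V : opens T) p : V p -> V spec_generic.
Proof.
move=> Vp; have oV : zariski_open V := oset_open V.
have [f [fp hf]] := oV p Vp; apply: hf => /= f0.
by apply: fp; rewrite f0; exact: prime_ideal0 (pprime p).
Qed.

Lemma spec_sheaf_proof : is_sheaf spec_ringed.
Proof.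
move=> I V U hU s cov agr.
have /choice[idx hidx] : forall p : {p : T | V p}, exists i, U i (sval p).
  by move=> [p Vp]; have [i Uip] := cov p Vp; exists i.
pose t (p : {p : T | V p}) : K := s (idx p) (exist _ (sval p) (hidx p)).
have tE p i (Uip : U i (sval p)) : t p = s i (exist _ (sval p) Uip).
  pose W : opens T := opensI (U (idx p)) (U i).
  have hi : W `<=` U (idx p) by move=> q [].
  have hj : W `<=` U i by move=> q [].
  pose pW : {q : T | W q} := exist _ (sval p) (conj (hidx p) Uip).
  have E := congr1 (fun f : spec_sect W => f pW) (agr (idx p) i W hi hj).
  have /regularP[sc _] := sect_funP (s (idx p) : spec_sect (U (idx p))).
  have /regularP[sc' _] := sect_funP (s i : spec_sect (U i)).
  by rewrite /t (sc _ (spec_incl hi pW)) [LHS]E; exact: sc'.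
have treg : t \in @regular V.
  apply/regularP; split; last first.
    by move=> p; have /regularP[_ sr] := sect_funP (s (idx p)); exact: sr (exist _ _ _).
  have gen (p : {p : T | V p}) (Vt : V spec_generic) : t p = t (exist _ spec_generic Vt).
    have Ut := spec_generic_in (hidx p).
    rewrite (tE (exist _ spec_generic Vt) (idx p) Ut).
    by have /regularP[sc _] := sect_funP (s (idx p)); exact: sc.
  move=> p q; have Vt := spec_generic_in (proj2_sig p).
  by rewrite (gen p Vt) (gen q Vt).
exists (SpecSect treg : spec_sect V); split.
  by move=> i; apply: spec_sect_eq => -[p Up]; exact: (tE (spec_incl (hU i) _)).
move=> t' ht'; apply: spec_sect_eq => p /=.
rewrite /t -(ht' (idx p)) /=.
by have /regularP[sc _] := sect_funP (t' : spec_sect V); exact: sc.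
Qed.

Lemma spec_const_subproof (V : opens T) (a : G) :
  (fun=> gam a) \in @regular V.
Proof.
apply/regularP; split=> // p; exists a, 1; rewrite rmorph1 mulr1.
by split=> //; exact: prime_ideal1 (pprime _).
Qed.

Definition spec_const (V : opens T) (a : G) : spec_sect V :=
  SpecSect (spec_const_subproof V a).

(** The denominators of an element of [K] form an ideal; if the element is
    regular wherever [f] does not vanish, then no prime without [f] contains
    this ideal, so that some power of [f] is a denominator. *)
Lemma regular_fraction (f : G) (z : K) :
  (forall p : T, ~ pset p f -> regular_at p z) ->
  exists a n, z * gam f ^+ n = gam a.
Proof.
move=> hz; apply: contrapT => nz.
have [||||p [pp Ip pf]] :=
    @prime_ideal_avoiding G [set b | exists a, z * gam b = gam a] f.
- by exists 0; rewrite rmorph0 mulr0.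
- by move=> a b [c ac] [d bd]; exists (c + d); rewrite !rmorphD mulrDr ac bd.
- by move=> a b [c bc]; exists (a * c); rewrite !rmorphM mulrCA bc.
- by move=> n [a aE]; apply: nz; exists a, n; rewrite -aE rmorphXn.
have [a [b [pb ab]]] := hz (PrimePoint pp) pf.
by apply: pb; apply: Ip; exists a.
Qed.

Lemma spec_sect_const (V : opens T) (s : spec_sect V) p q : s p = s q.
Proof. by have /regularP[sc _] := sect_funP s; exact: sc. Qed.

(** The whole space is affine, since its global sections are the elements of [G]
    by [regular_fraction] for [f = 1]. *)
Lemma spec_affine (x : spec_ringed) :
  exists U : opens spec_ringed, U x /\ affine U.
Proof.
exists (opens_setT spec_ringed); split=> //.
pose VT := opens_setT T; pose TT p : {p : T | VT p} := exist _ p I.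
have gE (s : spec_sect VT) : exists a, forall p, s p = gam a.
  have [p|a [n]] := @regular_fraction 1 (s (TT spec_generic)).
    move=> _; have /regularP[_ sr] := sect_funP s.
    by rewrite (spec_sect_const s _ (TT p)); exact: sr (TT p).
  rewrite rmorph1 expr1n mulr1 => sa; exists a => p; rewrite -sa.
  exact: spec_sect_const.
pose phi (p : spec_ringed) : set (sect (opens_setT spec_ringed)) :=
  [set s | exists2 a, pset p a & s = spec_const VT a].
have cI : injective (spec_const VT).
  by move=> a b /(congr1 (fun s : spec_sect VT => s (TT spec_generic)))/gamI.
have gC (s : spec_sect VT) : exists a, s = spec_const VT a.
  by have [a sa] := gE s; exists a; exact: spec_sect_eq.
have phiE p a : phi p (spec_const VT a) <-> pset p a.
  by split=> [[b pb /cI ->] //|pa]; exists a.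
have c0 : spec_const VT 0 = 0 by apply: spec_sect_eq => p; exact: rmorph0.
have c1 : spec_const VT 1 = 1 by apply: spec_sect_eq => p; exact: rmorph1.
have cD a b : spec_const VT (a + b) = spec_const VT a + spec_const VT b.
  by apply: spec_sect_eq => p; exact: rmorphD.
have cM a b : spec_const VT (a * b) = spec_const VT a * spec_const VT b.
  by apply: spec_sect_eq => p; exact: rmorphM.
exists phi; split.
- move=> p _; have pp := pprime p; split.
  + by rewrite -[X in phi p X]c0; apply/phiE; exact: prime_ideal0.
  + move=> _ _ [a pa ->] [b pb ->]; rewrite -[X in phi p X]cD; apply/phiE.
    exact: prime_idealD.
  + move=> s _ [b pb ->]; have [a ->] := gC s; rewrite -[X in phi p X]cM.
    by apply/phiE; exact: prime_idealMl.
  + by rewrite -[X in phi p X]c1 => /phiE; exact: prime_ideal1.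
  + move=> s t; have [a ->] := gC s; have [b ->] := gC t.
    rewrite -[X in phi p X]cM => /phiE/(prime_idealM pp)[]; [left|right];
      exact/phiE.
- move=> p q _ _ pq; apply: prime_point_inj; apply/seteqP.
  by split=> a /phiE; [rewrite pq|rewrite -pq] => /phiE.
- move=> P PP.
  have pp : prime_ideal (spec_const VT @^-1` P).
    split=> /=.
    + by rewrite c0; exact: (prime_ideal0 PP).
    + by move=> a b; rewrite cD; exact: (prime_idealD PP).
    + by move=> a b; rewrite cM; exact: (prime_idealMl PP).
    + by rewrite c1; exact: (prime_ideal1 PP).
    + by move=> a b; rewrite cM; exact: (prime_idealM PP).
  exists (PrimePoint pp) => //; apply/seteqP; split=> [_ [a Pa ->]//|s].
  by have [a ->] := gC s => Pa; exists a.
- move=> W _; rewrite -[open W]/(@zariski_open G W).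
  split=> [oW p Wp|H p Wp].
    have [f [fp hf]] := oW p Wp; exists (spec_const VT f).
    split; first by move/phiE.
    by move=> q _ fq; apply: hf => qf; apply: fq; exact/phiE.
  have [s [sp hs]] := H p Wp; have [f fE] := gC s; rewrite fE in sp hs.
  exists f; split; first by move=> pf; apply: sp; exact/phiE.
  by move=> q fq; apply: hs => // /phiE.
- move=> s W h; have [f ->] := gC s => WE.
  have We p : W p <-> ~ pset p f.
    rewrite WE; split=> [[_ nf] pf|nf]; first by apply: nf; exact/phiE.
    by split=> // /phiE.
  split.
  + have ri : (fun=> (gam f)^-1) \in @regular W.
      apply/regularP; split=> // -[p /= Wp]; exists 1, f.
      have nf : ~ pset p f by exact/We.
      rewrite rmorph1 mulVf //; apply/eqP => /= f0; apply: nf.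
      by rewrite -(rmorph0 gam) in f0; rewrite (gamI f0);
        exact: prime_ideal0 (pprime p).
    exists (SpecSect ri : spec_sect W); apply: spec_sect_eq => -[p Wp] /=.
    rewrite /=; apply: divff; apply/eqP => /= f0; have /We := Wp; apply.
    by rewrite -(rmorph0 gam) in f0; rewrite (gamI f0);
      exact: prime_ideal0 (pprime p).
  + move=> b.
    have [[p Wp]|nW] := pselect (exists p, W p); last first.
      exists 0, 0%N; apply: spec_sect_eq => -[p Wp]; by case: nW; exists p.
    have Wt := spec_generic_in Wp.
    have [q /We Wq|a [n bE]] :=
        @regular_fraction f ((b : spec_sect W) (exist _ spec_generic Wt)).
      rewrite (spec_sect_const _ _ (exist _ q Wq)).
      have /regularP[_ sr] := sect_funP (b : spec_sect W).
      exact: sr (exist _ q Wq).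
    exists (spec_const VT a), n; apply: spec_sect_eq => q.
    rewrite [RHS]/= -bE.
    rewrite (spec_sect_const (b : spec_sect W) (exist _ spec_generic Wt) q).
    rewrite -[LHS]/((b : spec_sect W) q * _); congr (_ * _).
    exact: (spec_funX (spec_res h (spec_const VT f))).
  + move=> t; have [a ->] := gC t => a0.
    have [[p Wp]|nW] := pselect (exists p, W p); last first.
      exists 1%N; rewrite expr1 -[LHS]cM -[RHS]c0; congr (spec_const _ _).
      have -> : f = 0; last by rewrite mul0r.
      apply: contrapT => f0; apply: nW; exists spec_generic.
      by apply/We => /= ?; exact: f0.
    exists 0%N; rewrite expr0 mul1r.
    have E : gam a = 0 := congr1 (fun u : spec_sect W => u (exist _ p Wp)) a0.
    rewrite -(rmorph0 gam) in E; rewrite (gamI E); exact: c0.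
Qed.

Context (k : fieldType) (c : {rmorphism k -> G}).

Lemma spec_const_zmod (V : opens T) : zmod_morphism (spec_const V).
Proof. by move=> a b; apply: spec_sect_eq => p; exact: rmorphB. Qed.

Lemma spec_const_monoid (V : opens T) : monoid_morphism (spec_const V).
Proof.
by split=> [|a b]; apply: spec_sect_eq => p; [exact: rmorph1|exact: rmorphM].
Qed.

HB.instance Definition _ (V : opens T) :=
  GRing.isZmodMorphism.Build _ _ (spec_const V) (spec_const_zmod V).
HB.instance Definition _ (V : opens T) :=
  GRing.isMonoidMorphism.Build _ _ (spec_const V) (spec_const_monoid V).

Definition spec_kscheme : kscheme k :=
  @KScheme k (Scheme spec_sheaf_proof spec_affine)
    (spec_const (opens_setT T) \o c).

End Spec.

(** * Morphisms from the spectrum of a domain *)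

Section SpecMorphism.
Context (k : fieldType) (G : comPzRingType) (K : fieldType).
Context (gam : {rmorphism G -> K}) (gamI : injective gam).
Context (c : {rmorphism k -> G}).
Local Notation T := (prime_point G).
Local Notation specG := (spec_kscheme gamI c).

Lemma spec_invertible_at (V : opens T) (s : spec_sect gam V)
  (p : {p : T | V p}) :
  @invertible_at (spec_ringed gam) V s (sval p) ->
  exists a b, [/\ ~ pset (sval p) a, ~ pset (sval p) b & s p * gam b = gam a].
Proof.
move=> [W [h [Wp [t st]]]].
pose pW : {p : T | W p} := exist _ (sval p) Wp.
have E : s p * (t : spec_sect gam W) pW = 1.
  rewrite (spec_sect_const s p (spec_incl h pW)).
  exact: (congr1 (fun u : spec_sect gam W => u pW) st).
have /regularP[_ /(_ p)[a [b [pb ab]]]] := sect_funP s.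
have /regularP[_ /(_ pW)[a' [b' [pb' ab']]]] := sect_funP (t : spec_sect gam W).
exists a, b; split=> // pa.
have aabb : a * a' = b * b'.
  by apply: gamI; rewrite !rmorphM -ab -ab' mulrACA E mul1r.
have : pset (sval p) (b * b').
  by rewrite -aabb; exact: prime_idealMr (pprime _) pa.
by move=> /(prime_idealM (pprime _))[].
Qed.

Lemma spec_generic_invertible (V : opens T) (s : spec_sect gam V)
  (p : {p : T | V p}) : s p != 0 ->
  @invertible_at (spec_ringed gam) V s (spec_generic gamI).
Proof.
move=> sp0; pose t : {p : T | V p} :=
  exist _ (spec_generic gamI) (spec_generic_in gamI (proj2_sig p)).
have st0 : s t != 0 by rewrite (spec_sect_const s t p).
have /regularP[_ /(_ t)[a [b [b0 ab]]]] := sect_funP s.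
have a0 : a <> 0.
  move=> a0; move/eqP: ab; rewrite a0 rmorph0 mulf_eq0 (negbTE st0) /=.
  by rewrite -(rmorph0 gam) => /eqP/gamI.
have oW : open [set q : T | V q /\ ~ pset q a].
  apply: openI; first exact: oset_open.
  by rewrite zariski_openE => q qa; exists a.
pose W : opens T := Opens oW.
have h : W `<=` V by move=> q [].
have ga q : W q -> gam a != 0.
  move=> [_ qa]; apply/eqP; rewrite -(rmorph0 gam) => /gamI a0'; apply: qa.
  by rewrite a0'; exact: prime_ideal0 (pprime q).
have inv : (fun=> gam b / gam a) \in @regular _ _ gam W.
  apply/regularP; split=> // -[q Wq]; exists b, a; split; first by case: Wq.
  by rewrite divfK // (ga q).
exists W, h; split; first by split=> //; exact: proj2_sig t.
exists (SpecSect inv : spec_sect gam W); apply: spec_sect_eq => q.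
rewrite -[LHS]/(s (spec_incl h q) * (gam b / gam a)) (spec_sect_const s _ t).
by rewrite mulrA ab divff // (ga _ (proj2_sig q)).
Qed.

(** A morphism to [Y] is determined by the map [f] on points and by the values
    in [K] of the pullbacks of sections at the generic point, since sections over
    open sets of the spectrum are elements of [K]. It remains to require that
    these values are regular and that invertibility is reflected. *)
Context (Y : kscheme k) (f : T -> Y) (fcont : continuous f) (y0 : Y).
Hypothesis fgen : f (spec_generic gamI) = y0.
Context (e : forall V : opens Y, V y0 -> {rmorphism sect V -> K}).
Hypothesis e_res : forall (U V : opens Y) (hU : U y0) (hV : V y0)
  (h : V `<=` U) (s : sect U), e hV (res h s) = e hU s.
Hypothesis e_reg : forall (V : opens Y) (hV : V y0) (s : sect V) (p : T),
  V (f p) -> regular_at gam p (e hV s).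
Hypothesis e_loc : forall (V : opens Y) (hV : V y0) (s : sect V) (p : T),
  V (f p) ->
  (exists a b, [/\ ~ pset p a, ~ pset p b & e hV s * gam b = gam a]) ->
  invertible_at s (f p).
Hypothesis e_cst : forall (hT : opens_setT Y y0) (l : k),
  e hT (kstr Y l) = gam (c l).

Lemma spec_pull_in (V : opens Y) (p : {p : T | opens_preimage fcont V p}) : V y0.
Proof.
rewrite -fgen; exact: (spec_generic_in gamI (V := opens_preimage fcont V)
  (proj2_sig p)).
Qed.

Lemma spec_pull_subproof (V : opens Y) (s : sect V) :
  (fun p => e (spec_pull_in p) s) \in @regular _ _ gam (opens_preimage fcont V).
Proof.
apply/regularP; split=> [p q|p]; last by apply: e_reg; exact: proj2_sig p.
by rewrite (Prop_irrelevance (spec_pull_in p) (spec_pull_in q)).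
Qed.

Definition spec_pull (V : opens Y) (s : sect V) :
  spec_sect gam (opens_preimage fcont V) := SpecSect (spec_pull_subproof s).

Lemma spec_pull_zmod (V : opens Y) : zmod_morphism (@spec_pull V).
Proof. by move=> s t; apply: spec_sect_eq => p; exact: rmorphB. Qed.

Lemma spec_pull_monoid (V : opens Y) : monoid_morphism (@spec_pull V).
Proof.
by split=> [|s t]; apply: spec_sect_eq => p; [exact: rmorph1|exact: rmorphM].
Qed.

HB.instance Definition _ (V : opens Y) :=
  GRing.isZmodMorphism.Build _ _ (@spec_pull V) (@spec_pull_zmod V).
HB.instance Definition _ (V : opens Y) :=
  GRing.isMonoidMorphism.Build _ _ (@spec_pull V) (@spec_pull_monoid V).

Lemma spec_mor_exists : exists g : kmor specG Y,
  (forall p, g p = f p) /\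
  forall (V : opens Y) (hV : V y0) (s : sect V)
    (p : {p : T | opens_preimage (@kmap_cont _ _ _ g) V p}),
    (kcom g V s : spec_sect gam _) p = e hV s.
Proof.
pose pull (V : opens Y) :
  {rmorphism sect V -> @sect specG (opens_preimage fcont V)} := @spec_pull V.
have pres (V W : opens Y) (h : W `<=` V) (s : sect V) :
    @agree specG _ _ (pull V s) (pull W (res h s)).
  by move=> N hV hW; apply: spec_sect_eq => p; exact/esym/e_res.
have ploc (V : opens Y) (s : sect V) (x : specG) : V (f x) ->
    invertible_at (pull V s) x -> invertible_at s (f x).
  move=> Vx ix; pose x' : {p : T | opens_preimage fcont V p} := exist _ x Vx.
  have [a [b [xa xb ab]]] := @spec_invertible_at _ (pull V s) x' ix.
  by apply: (e_loc (hV := spec_pull_in x')) => //; exists a, b.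
have pcst (l : k) : @agree specG _ _ (pull (opens_setT Y) (kstr Y l)) (kstr specG l).
  by move=> N h h'; apply: spec_sect_eq => p; exact: e_cst.
exists (KMor (X := specG) (kcom := pull) pres ploc pcst); split=> //.
move=> V hV s p /=; by rewrite (Prop_irrelevance (spec_pull_in p) hV).
Qed.

End SpecMorphism.

(** * Consequences of separatedness *)

Section Separated.
Context (k : fieldType) (X : kscheme k) (F : function_field X).
Local Notation x0 := (ff_point F).
Local Notation K := (ff_field F).
Local Notation gam hV := (ff_map F hV).

Definition kcst_mor (U : opens X) : {rmorphism k -> sect U} :=
  (res (U := opens_setT X) (@subsetT _ U)) \o kstr X.

Lemma kcst_res (U V : opens X) (h : V `<=` U) (l : k) :
  res h (kcst U l) = kcst V l.
Proof. exact: res_comp. Qed.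

Lemma ff_map_eq0 (V : opens X) (hV : V x0) s : gam hV s = 0 -> s = 0.
Proof. by rewrite -(rmorph0 (gam hV)) => /ff_inj. Qed.

Lemma ff_fraction_invertible (U V : opens X) (hU : U x0) (hV : V x0)
  (s : sect V) (h r : sect U) (x : X) : U x -> V x ->
  gam hV s * gam hU h = gam hU r -> invertible_at r x -> invertible_at s x.
Proof.
move=> Ux Vx E ir; pose W := opensI U V; have hW : W x0 by [].
have WU : W `<=` U by move=> y [].
have WV : W `<=` V by move=> y [].
have E' : res WV s * res WU h = res WU r.
  by apply: (ff_inj hW); rewrite rmorphM (ff_res hV) !(ff_res hU).
have Wx : W x by [].
apply/(@invertible_at_res _ _ _ WV s x Wx).
have : invertible_at (res WU r) x by apply/invertible_at_res.
by rewrite -E' => /invertible_atM[].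
Qed.

Lemma ff_agree (V W : opens X) (hV : V x0) (hW : W x0) (s : sect V)
  (t : sect W) : agree s t -> gam hV s = gam hW t.
Proof.
pose N := opensI V W; have hN : N x0 by [].
have NV : N `<=` V by move=> y [].
have NW : N `<=` W by move=> y [].
by move=> /(_ N NV NW) st; rewrite -(ff_res hV hN NV) st ff_res.
Qed.

Section AffineMorphism.
Context (U : opens X) (phi : X -> set (sect U)) (hphi : is_spec_iso phi).
Context (N : opens X) (hNU : N `<=` U) (hN : N x0).
Local Notation specN := (spec_kscheme (ff_inj hN) (kcst_mor N)).

Lemma generic_pointE x : U x -> phi x = [set 0] -> x = x0.
Proof.
move=> Ux xE; have Ux0 : U x0 := hNU hN.
apply: (spec_inj hphi Ux Ux0); rewrite xE; apply/seteqP; split=> s /=.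
  by move=> ->; exact: prime_ideal0 (spec_prime hphi Ux0).
move=> /(spec_pointE hphi _ Ux0) ns; apply: (@ff_map_eq0 U Ux0).
by apply/eqP; apply: contra_notT ns => /ff_unit.
Qed.

Lemma affine_fraction (V : opens X) (hV : V x0) (hU : U x0) (s : sect V) x :
  U x -> V x ->
  exists h r, invertible_at h x /\ gam hV s * gam hU h = gam hU r.
Proof.
move=> Ux Vx.
have [h [r [W [WU [WV [Wx ih E]]]]]] := section_fraction hphi s Ux Vx.
exists h, r; split; first by exists W, WU.
have hW : W x0 := ff_generic F Wx.
by rewrite -(ff_res hV hW WV) -!(ff_res hU hW WU) -E rmorphM.
Qed.

Lemma affine_mor_exists : exists g : kmor specN X,
  (forall p : prime_point (sect N), U (g p) /\ phi (g p) = res hNU @^-1` pset p) /\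
  forall (V : opens X) (hV : V x0) (s : sect V)
    (p : {p : prime_point (sect N) | opens_preimage (@kmap_cont _ _ _ g) V p}),
    (kcom g V s : spec_sect (gam hN) _) p = gam hV s.
Proof.
have hU : U x0 := hNU hN.
have gN s : gam hN (res hNU s) = gam hU s by exact: ff_res.
have /choice[f fE] : forall p : prime_point (sect N), exists x, U x /\
    phi x = res hNU @^-1` pset p.
  move=> p; have pp := prime_ideal_preimage (res hNU) (pprime p).
  by have [x Ux xE] := spec_surj hphi pp; exists x.
have fcont : continuous f.
  apply/continuousP => V oV; rewrite zariski_openE => p Vfp.
  have [Uf fp] := fE p.
  have [h [hp hh]] := basic_open_basis (V := Opens oV) hphi Uf Vfp.
  exists (res hNU h); split; first by move: hp; rewrite fp.
  by move=> q qh; apply: hh; have [Uq fq] := fE q; split=> //; rewrite fq.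
have fgen : f (spec_generic (ff_inj hN)) = x0.
  have [Uf ff] := fE (spec_generic (ff_inj hN)).
  apply: generic_pointE => //; rewrite ff; apply/seteqP; split=> s /=.
    by move=> s0; apply: (@ff_map_eq0 U hU); rewrite -gN s0 rmorph0.
  by move=> ->; exact: rmorph0.
have inv p h : invertible_at h (f p) -> ~ pset p (res hNU h).
  have [Uf ff] := fE p; move=> /(spec_point_notE hphi _ Uf); by rewrite ff.
have [||||g [gE gs]] := @spec_mor_exists k (sect N) K (gam hN)
    (ff_inj hN) (kcst_mor N) X f fcont x0 fgen (fun V hV => gam hV).
- by move=> V W hV hW h s; exact: ff_res.
- move=> V hV s p Vf; have [Uf _] := fE p.
  have [h [r [ih E]]] := affine_fraction hV hU s Uf Vf.
  by exists (res hNU r), (res hNU h); split; [exact: inv|rewrite !gN].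
- move=> V hV s p Vf [a [b [pa pb ab]]]; have [Uf ff] := fE p.
  have [h [r [ih E]]] := affine_fraction hV hU s Uf Vf.
  apply: (ff_fraction_invertible Uf Vf E).
  apply/(spec_point_notE hphi _ Uf); rewrite ff /= => pr.
  have rb : res hNU r * b = a * res hNU h.
    by apply: (ff_inj hN); rewrite !rmorphM !gN -E -ab mulrAC.
  have : pset p (a * res hNU h).
    by rewrite -rb; exact: prime_idealMr (pprime p) pr.
  by move=> /(prime_idealM (pprime p))[//|]; exact: inv.
- by move=> hT l; rewrite /= (ff_res hT).
exists g; split=> [p|V hV s p]; last exact: gs.
by rewrite gE.
Qed.

End AffineMorphism.

(** The spectrum of [K] has one point, where every value is regular; a morphism
    from it only has to reflect invertibility at the image [y]. *)
Lemma field_mor_exists (c : {rmorphism k -> K}) (Y : kscheme k) (y : Y)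
  (e : forall V : opens Y, V y -> {rmorphism sect V -> K}) :
  (forall (U V : opens Y) (hU : U y) (hV : V y) (h : V `<=` U) (s : sect U),
     e V hV (res h s) = e U hU s) ->
  (forall (V : opens Y) (hV : V y) (s : sect V), e V hV s != 0 ->
     invertible_at s y) ->
  (forall (hT : opens_setT Y y) (l : k), e _ hT (kstr Y l) = c l) ->
  exists g : kmor (spec_kscheme (gam := (idfun : {rmorphism K -> K}))
                     (@inj_id K) c) Y,
  (forall p, g p = y) /\
  forall (V : opens Y) (hV : V y) (s : sect V)
    (p : {p : prime_point K | opens_preimage (@kmap_cont _ _ _ g) V p}),
    (kcom g V s : spec_sect (idfun : {rmorphism K -> K}) _) p = e V hV s.
Proof.
move=> eres eloc ecst.
have fcont : continuous (fun _ : prime_point K => y) by exact: cst_continuous.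
apply: (@spec_mor_exists k K K idfun (@inj_id K) c Y _ fcont y erefl e) => //.
- move=> V hV s p _; exists (e V hV s), 1; rewrite mulr1; split=> //.
  exact: prime_ideal1 (pprime p).
- move=> V hV s p _ [a [b [pa pb ab]]]; apply: (eloc _ hV).
  apply/eqP => e0; apply: pa; rewrite -[a]/(idfun a) -ab e0 mul0r.
  exact: prime_ideal0 (pprime p).
Qed.

Lemma spec_agree_eval (G : comPzRingType) (L : fieldType)
  (g : {rmorphism G -> L}) (V W : opens (prime_point G))
  (s : spec_sect g V) (t : spec_sect g W)
  (p : {p : prime_point G | V p}) (q : {p : prime_point G | W p}) :
  @agree (spec_ringed g) V W s t -> sval p = sval q -> s p = t q.
Proof.
case: p q => [p Vp] [q Wq] st /= pq; rewrite -pq in Wq *.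
pose N := opensI V W.
have NV : N `<=` V by move=> y [].
have NW : N `<=` W by move=> y [].
pose r : {p : prime_point G | N p} := exist _ p (conj Vp Wq).
rewrite (spec_sect_const s _ (spec_incl NV r)).
rewrite (spec_sect_const t _ (spec_incl NW r)).
exact: (congr1 (fun u : spec_sect g N => u r) (st N NV NW)).
Qed.

(** Let [T] be the spectrum of the ring of sections over the intersection [N].
    The morphisms [g1] and [g2] from [T] to [U1] and [U2] define a morphism [h]
    from [T] to the square [P] of [X]. At the generic point of [T] both are the
    generic point of [X], with values in [K]; hence [h] maps the generic point of
    [T] to the diagonal, by the uniqueness part of the universal property of [P]
    for the spectrum of [K]. As the diagonal is closed, [h] maps all of [T] to
    it, and [g1 = g2] at the point [q]. *)
Lemma separated_affine_points (U1 U2 : opens X) (phi1 : X -> set (sect U1))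
  (phi2 : X -> set (sect U2)) (h1 : opensI U1 U2 `<=` U1)
  (h2 : opensI U1 U2 `<=` U2) (q : set (sect (opensI U1 U2))) (x1 x2 : X) :
  Defs.separated X -> is_spec_iso phi1 -> is_spec_iso phi2 ->
  opensI U1 U2 x0 -> prime_ideal q ->
  U1 x1 -> phi1 x1 = res h1 @^-1` q -> U2 x2 -> phi2 x2 = res h2 @^-1` q ->
  x1 = x2.
Proof.
move=> [P [p1 [p2 [d [sq [d1x d1s] [d2x d2s] cd]]]]] hphi1 hphi2 hN pq.
move=> Ux1 x1E Ux2 x2E.
set N := opensI U1 U2 in h1 h2 q hN pq x1E x2E.
have [g1 [g1E g1s]] := affine_mor_exists hphi1 h1 hN.
have [g2 [g2E g2s]] := affine_mor_exists hphi2 h2 hN.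
have [[h [[hp1x hp1s] [hp2x hp2s]]] _] := sq _ g1 g2.
pose tau : prime_point (sect N) := spec_generic (ff_inj hN).
have gtau (U : opens X) (phi : X -> set (sect U)) (hU : N `<=` U)
    (hphi : is_spec_iso phi) (x : X) : U x ->
    phi x = res hU @^-1` pset tau -> x = x0.
  move=> Ux xE; apply: (generic_pointE hphi hU hN) => //.
  rewrite xE; apply/seteqP; split=> s /=; last by move=> ->; exact: rmorph0.
  move=> s0; apply: (@ff_map_eq0 U (hU _ hN)).
  by rewrite -(ff_res (hU _ hN) hN) s0 rmorph0.
have g1t : g1 tau = x0 by have [? ?] := g1E tau; exact: (gtau _ _ h1 hphi1).
have g2t : g2 tau = x0 by have [? ?] := g2E tau; exact: (gtau _ _ h2 hphi2).
pose c : {rmorphism k -> K} := (gam hN) \o kcst_mor N.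
pose specN := spec_kscheme (ff_inj hN) (kcst_mor N).
pose at_tau (V : opens P) (hV : V (h tau)) :
  {p : prime_point (sect N) | opens_preimage (@kmap_cont _ _ _ h) V p} :=
  exist _ tau hV.
pose ev (V : opens P) (hV : V (h tau)) : {rmorphism sect V -> K} :=
  (spec_eval (at_tau V hV)) \o (kcom h V).
pose dv (V : opens P) (hV : V (d x0)) : {rmorphism sect V -> K} :=
  (ff_map F (hV : opens_preimage (@kmap_cont _ _ _ d) V x0)) \o (kcom d V).
have aev (V W : opens P) (hV : V (h tau)) (hW : W (h tau))
    (s : sect (opens_preimage (@kmap_cont _ _ _ h) V))
    (t : sect (opens_preimage (@kmap_cont _ _ _ h) W)) : agree s t ->
    spec_eval (at_tau V hV) s = spec_eval (at_tau W hW) t.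
  move=> st.
  exact: (@spec_agree_eval _ _ (gam hN) _ _ s t (at_tau V hV) (at_tau W hW) st).
(* [h0] is the restriction of [h] to the generic point, and [d0] is the diagonal
   applied to the generic point [g0] of [X]; both are points of [P] with values
   in [K]. *)
have [||| h0 [h0x h0s]] := @field_mor_exists c P (h tau) ev.
- by move=> U V hU hV hUV s; apply/esym/aev; exact: kcom_res.
- move=> V hV s s0; apply: (@kcom_local _ _ _ h V s tau hV).
  exact: (@spec_generic_invertible _ _ _ (ff_inj hN) _ _ (at_tau V hV) s0).
- move=> hT l.
  have E := @spec_agree_eval _ _ (gam hN) _ _ _ _ (at_tau _ hT)
    (exist (opens_setT (prime_point (sect N))) tau I) (@kcom_cst _ _ _ h l).
  exact: (E erefl).
have [||| d0 [d0x d0s]] := @field_mor_exists c P (d x0) dv.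
- by move=> U V hU hV hUV s; apply/esym/ff_agree; exact: kcom_res.
- move=> V hV s s0; apply: (@kcom_local _ _ _ d V s x0 hV); exact: ff_unit s0.
- move=> hT l; have hT' : opens_setT X x0 by [].
  by rewrite /dv /= (ff_agree _ hT' (@kcom_cst _ _ _ d l)) (ff_res hT').
have [||| g0 [g0x g0s]] := @field_mor_exists c X x0 (fun V hV => ff_map F hV).
- by move=> U V hU hV hUV s; exact: ff_res.
- by move=> V hV s; exact: ff_unit.
- by move=> hT l; rewrite /= (ff_res hT).
have [_ uniq1] := sq _ g0 g0.
have h0comp (p : kmor P X) (g : kmor specN X) : kmor_comp h p g -> g tau = x0 ->
    (forall (V : opens X) (hV : V x0) (s : sect V)
      (t : {p : prime_point (sect N) | opens_preimage (@kmap_cont _ _ _ g) V p}),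
      (kcom g V s : spec_sect (gam hN) _) t = gam hV s) ->
    kmor_comp h0 p g0.
  move=> [px ps] gt gs; split=> [x|V s W hU hV].
    by rewrite h0x g0x px.
  apply: spec_sect_eq => t.
  rewrite -[LHS]/((kcom h0 _ (kcom p V s) : spec_sect _ _) (spec_incl hU t)).
  rewrite -[RHS]/((kcom g0 V s : spec_sect _ _) (spec_incl hV t)).
  have Vx0 : V x0 by have := hV _ (proj2_sig t); rewrite /= /opens_mem /= g0x.
  rewrite (g0s _ Vx0).
  have Vh : opens_preimage (@kmap_cont _ _ _ p) V (h tau).
    by rewrite /opens_mem /= px gt.
  have Vg : opens_preimage (@kmap_cont _ _ _ g) V tau.
    by rewrite /opens_mem /= gt.
  rewrite (h0s _ Vh) -(gs V Vx0 s (exist _ tau Vg)).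
  exact: (@spec_agree_eval _ _ (gam hN) _ _ _ _ (at_tau _ Vh) (exist _ tau Vg)
    (ps V s) erefl).
have d0comp (p : kmor P X) : kmor_section d p -> kmor_comp d0 p g0.
  move=> [px ps]; split=> [x|V s W hU hV].
    by rewrite d0x g0x px.
  apply: spec_sect_eq => t.
  rewrite -[LHS]/((kcom d0 _ (kcom p V s) : spec_sect _ _) (spec_incl hU t)).
  rewrite -[RHS]/((kcom g0 V s : spec_sect _ _) (spec_incl hV t)).
  have Vx0 : V x0 by have := hV _ (proj2_sig t); rewrite /= /opens_mem /= g0x.
  rewrite (g0s _ Vx0).
  have Vd : opens_preimage (@kmap_cont _ _ _ p) V (d x0).
    by rewrite /opens_mem /= px.
  by rewrite (d0s _ Vd); exact: (ff_agree _ _ (ps V s)).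
have [hd _] := uniq1 h0 d0 (h0comp p1 g1 (conj hp1x hp1s) g1t g1s)
  (h0comp p2 g2 (conj hp2x hp2s) g2t g2s)
  (d0comp p1 (conj d1x d1s)) (d0comp p2 (conj d2x d2s)).
have ht : h tau = d x0.
  pose t0 := spec_generic (gam := (idfun : {rmorphism K -> K})) (@inj_id K).
  by have := hd t0; rewrite h0x d0x.
have cl : closed (h @^-1` (d @` setT)).
  apply: closed_comp; first by move=> t _; exact: kmap_cont.
  exact: (climm_closed cd closedT).
pose t : prime_point (sect N) := PrimePoint pq.
have [y _ dy] : (d @` setT) (h t).
  apply: contrapT => nt.
  have := @spec_generic_in _ _ _ (ff_inj hN) (Opens (closed_openC cl)) t nt.
  by apply; exists x0.
have [U1g g1x] := g1E t; have [U2g g2x] := g2E t.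
have <- : g1 t = x1 by apply: (spec_inj hphi1) => //; rewrite g1x x1E.
have <- : g2 t = x2 by apply: (spec_inj hphi2) => //; rewrite g2x x2E.
by rewrite -hp1x -hp2x -dy d1x d2x.
Qed.
End Separated.

(** * Semivaluations and their centers *)

Section Semivaluations.
Context (k : fieldType) (R : realType).

Section Ring.
Context (A : comPzRingType) (c : {rmorphism k -> A}) (v : A -> \bar R).
Hypothesis sv : semivaluation c v.

Lemma semival1 : v 1 = 0%E.
Proof. by rewrite -(rmorph1 c) (semival_cst sv) ?oner_eq0. Qed.

Lemma semivalM0 a b : v b = 0%E -> v (a * b) = v a.
Proof. by move=> vb; rewrite (semivalM sv) vb adde0. Qed.

Lemma semival_eq0M a b : v (a * b) = 0%E <-> v a = 0%E /\ v b = 0%E.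
Proof.
rewrite (semivalM sv); split=> [|[-> ->]]; last by rewrite adde0.
move=> /eqP; rewrite padde_eq0 ?(semival_ge0 sv) // => /andP[/eqP -> /eqP ->].
by [].
Qed.

Lemma semival_gt0E a : (0 < v a)%E <-> v a <> 0%E.
Proof.
rewrite lt0e (semival_ge0 sv) andbT; split=> [/eqP//|h]; exact/eqP.
Qed.

Lemma semival_prime : prime_ideal [set a | v a <> 0%E].
Proof.
split=> /=.
- by rewrite (semival0 sv).
- move=> a b /semival_gt0E va /semival_gt0E vb; apply/semival_gt0E.
  by apply: lt_le_trans (semivalD sv a b); rewrite lt_min va.
- by move=> a b vb /semival_eq0M[].
- by rewrite semival1.
- move=> a b vab; have [va|] := pselect (v a = 0%E); last by left.
  by right => vb; apply: vab; apply/semival_eq0M.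
Qed.

End Ring.

Context (X : kscheme k) (F : function_field X).
Local Notation x0 := (ff_point F).
Local Notation K := (ff_field F).
Local Notation gam hV := (ff_map F hV).
Local Notation semival V := (@semivaluation k R (sect V) (kcst_mor V)).

Definition is_center (U : opens X) (v : sect U -> \bar R) (x : X) :=
  U x /\ forall s, v s = 0%E <-> invertible_at s x.

Lemma ff_cst (V W : opens X) (hV : V x0) (hW : W x0) (l : k) :
  gam hV (kcst_mor V l) = gam hW (kcst_mor W l).
Proof.
have hT : opens_setT X x0 by [].
by rewrite /= !(ff_res hT).
Qed.

(** The extension of [v] to the local ring of its center, which does not depend
    on the open set on which [v] is given. *)
Definition local_val (U : opens X) (v : sect U -> \bar R) (z : K) (t : \bar R) :=
  exists (hU : U x0) (r h : sect U),
    [/\ v h = 0%E, z * gam hU h = gam hU r & v r = t].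

Definition local_data (U : opens X) (v : sect U -> \bar R) :
  set X * set (K * \bar R) :=
  ([set x | is_center v x], [set zt | local_val v zt.1 zt.2]).

Lemma semival_res (U V : opens X) (h : V `<=` U) (w : sect V -> \bar R) :
  semival V w -> semival U (w \o res h).
Proof.
move=> sw; split=> /=.
- by move=> a; exact: semival_ge0 sw _.
- by move=> a b; rewrite rmorphM (semivalM sw).
- by move=> a b; rewrite rmorphD; exact: semivalD sw _ _.
- by rewrite rmorph0 (semival0 sw).
- by move=> l l0; rewrite kcst_res; exact: (semival_cst sw l0).
Qed.

Section LocalVal.
Context (U : opens X) (v : sect U -> \bar R).
Hypothesis sv : semival U v.

Lemma local_val_fun z t t' : local_val v z t -> local_val v z t' -> t = t'.
Proof.
move=> [hU [r [h [vh zh <-]]]] [hU' [r' [h' [vh' zh' <-]]]].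
have E : r * h' = r' * h.
  rewrite (Prop_irrelevance hU' hU) in zh'.
  by apply: (ff_inj hU); rewrite !rmorphM -zh -zh' mulrAC.
by rewrite -(semivalM0 sv r vh') E (semivalM0 sv).
Qed.

Lemma local_val_ge0 z t : local_val v z t -> (0 <= t)%E.
Proof. by move=> [hU [r [h [_ _ <-]]]]; exact: semival_ge0 sv _. Qed.

Lemma local_valM z t z' t' : local_val v z t -> local_val v z' t' ->
  local_val v (z * z') (t + t')%E.
Proof.
move=> [hU [r [h [vh zh <-]]]] [hU' [r' [h' [vh' zh' <-]]]].
exists hU, (r * r'), (h * h'); split; last exact: (semivalM sv).
  exact/(semival_eq0M sv).
rewrite (Prop_irrelevance hU' hU) in zh'.
by rewrite !rmorphM mulrACA zh zh'.
Qed.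

Lemma local_valD z t z' t' t'' : local_val v z t -> local_val v z' t' ->
  local_val v (z + z') t'' -> (Order.min t t' <= t'')%E.
Proof.
move=> [hU [r [h [vh zh <-]]]] [hU' [r' [h' [vh' zh' <-]]]] lt''.
have lD : local_val v (z + z') (v (r * h' + r' * h)).
  exists hU, (r * h' + r' * h), (h * h'); split=> //.
    exact/(semival_eq0M sv).
  rewrite (Prop_irrelevance hU' hU) in zh'.
  by rewrite rmorphD !rmorphM -zh -zh'; ring.
rewrite -(local_val_fun lD lt'') -(semivalM0 sv r vh') -(semivalM0 sv r' vh).
exact: semivalD sv _ _.
Qed.

Lemma local_val_sect (hU : U x0) s : local_val v (gam hU s) (v s).
Proof.
by exists hU, s, 1; rewrite rmorph1 mulr1 (semival1 sv).
Qed.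

Section Affine.
Context (phi : X -> set (sect U)) (hphi : is_spec_iso phi).

Lemma is_centerE x : U x ->
  is_center v x <-> phi x = [set s | v s <> 0%E].
Proof.
move=> Ux; split=> [[_ cx]|xE].
  apply/seteqP; split=> s /=.
    by move=> /(spec_pointE hphi _ Ux) ns /cx.
  by move=> vs; apply/(spec_pointE hphi _ Ux) => /cx.
split=> // s; rewrite -(spec_point_notE hphi _ Ux) xE /=; split=> [-> //|].
exact: contrapT.
Qed.

Lemma center_exists : exists x, is_center v x.
Proof.
have [x Ux xE] := spec_surj hphi (semival_prime sv).
by exists x; apply/is_centerE.
Qed.

Lemma center_unique x y : is_center v x -> is_center v y -> x = y.
Proof.
move=> cx cy; have [[Ux _] [Uy _]] := (cx, cy).
apply: (spec_inj hphi Ux Uy).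
by move/(is_centerE Ux): cx => ->; move/(is_centerE Uy): cy => ->.
Qed.

Lemma local_val_exists (x : X) (V : opens X) (hV : V x0) (s : sect V) :
  is_center v x -> V x -> exists t, local_val v (gam hV s) t.
Proof.
move=> [Ux cx] Vx; have hU := ff_generic F Ux.
have [h [r [ih E]]] := affine_fraction hphi hV hU s Ux Vx.
by exists (v r), hU, r, h; split=> //; apply/cx.
Qed.

(** Sections over a neighborhood of the center are fractions with a denominator
    of value 0. *)
Lemma semival_extension (x : X) (V : opens X) (hV : V x0) :
  is_center v x -> V x ->
  exists w, semival V w /\ forall s, local_val v (gam hV s) (w s).
Proof.
move=> cx Vx; have hU := ff_generic F cx.1.
have /choice[w hw] : forall s, exists t, local_val v (gam hV s) t.
  by move=> s; exact: local_val_exists cx Vx.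
exists w; split=> //; split.
- by move=> a; exact: local_val_ge0 (hw a).
- move=> a b; apply: (local_val_fun (hw (a * b))); rewrite rmorphM.
  exact: local_valM.
- by move=> a b; apply: (local_valD (hw a) (hw b)); rewrite -rmorphD; exact: hw.
- apply: (local_val_fun (hw 0)); rewrite rmorph0 -(rmorph0 (gam hU)).
  by rewrite -(semival0 sv); exact: local_val_sect.
- move=> l l0; apply: (local_val_fun (hw _)); rewrite -(semival_cst sv l0).
  rewrite (ff_cst hV hU); exact: local_val_sect.
Qed.

End Affine.
End LocalVal.

(** Near the center, sections over [W] are fractions of sections over [U] with a
    denominator of value 0, so that [w] is determined by its restriction. *)
Lemma local_data_res (U W : opens X) (h : W `<=` U) (w : sect W -> \bar R) :
  affine U -> affine W -> semival W w -> local_data (w \o res h) = local_data w.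
Proof.
move=> [phi hphi] [psi hpsi] sw; have sv := semival_res h sw.
have sub x : is_center w x -> is_center (w \o res h) x.
  move=> [Wx cx]; split; first exact: (h x Wx).
  by move=> s; rewrite /= cx; exact: invertible_at_res.
have [x cx] := center_exists sw hpsi; have [Wx _] := cx.
have hW := ff_generic F Wx; have hU := h _ hW.
congr pair; apply/seteqP; split.
- by move=> y cy; rewrite /= -(center_unique hphi (sub x cx) cy).
- exact: sub.
- move=> [z t] /= [hU' [r [f [vf zf <-]]]]; exists hW, (res h r), (res h f).
  by split=> //; rewrite !(ff_res hU').
move=> [z t] /= [hW' [r [f [vf zf <-]]]].
have cv := sub x cx.
have [tr lr] := local_val_exists hphi hW' r cv Wx.
have [tf lf] := local_val_exists hphi hW' f cv Wx.
have up s' t' : local_val (w \o res h) (gam hW' s') t' -> w s' = t'.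
  move=> [hU' [r' [f' [vf' zf' <-]]]] /=.
  rewrite /= in vf'; rewrite -(semivalM0 sw s' vf'); congr (w _).
  by apply: (ff_inj hW'); rewrite rmorphM !(ff_res hU').
have [hU' [r1 [h1 [vh1 rh1 vr1]]]] := lr.
have [hU'' [r2 [h2 [vh2 rh2 vr2]]]] := lf.
rewrite (Prop_irrelevance hU'' hU') in rh2.
exists hU', (r1 * h2), (h1 * r2); split.
- apply/(semival_eq0M sv); split=> //.
  by rewrite vr2 -(up _ _ lf).
- by rewrite !rmorphM -rh1 -rh2 -zf; ring.
- by rewrite (semivalM0 sv) // vr1 -(up _ _ lr).
Qed.

(** The common center lies in both open sets, so that the sections over the
    intersection belong to its local ring, to which [v1] and [v2] extend in the
    same way. *)
Lemma semival_common (U1 U2 : opens X) (h1 : opensI U1 U2 `<=` U1)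
  (h2 : opensI U1 U2 `<=` U2) (v1 : sect U1 -> \bar R) (v2 : sect U2 -> \bar R) :
  affine U1 -> affine U2 -> semival U1 v1 -> semival U2 v2 ->
  local_data v1 = local_data v2 ->
  exists w, [/\ semival (opensI U1 U2) w, forall s, v1 s = w (res h1 s) &
    forall s, v2 s = w (res h2 s)].
Proof.
move=> [phi1 hphi1] _ sv1 sv2 [cE lE].
have [x cx] := center_exists sv1 hphi1.
have [Ux1 _] := cx.
have [Ux2 _] : is_center v2 x by have : [set x | is_center v1 x] x; [|rewrite cE].
have Nx : opensI U1 U2 x by [].
have hN := ff_generic F Nx.
have [w [sw hw]] := semival_extension sv1 hphi1 hN cx Nx.
have lvE z t : local_val v2 z t -> local_val v1 z t.
  by move=> l2; have : [set zt | local_val v1 zt.1 zt.2] (z, t); [rewrite lE|].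
exists w; split=> // s; apply: (local_val_fun sv1 _ (hw _)).
  by rewrite (ff_res (h1 _ hN)); exact: local_val_sect.
by apply: lvE; rewrite (ff_res (h2 _ hN)); exact: local_val_sect.
Qed.

(** By separatedness both restrictions of [w] have the same center, and a
    principal open neighborhood of it in [U1] serves as [W]. *)
Lemma semival_affine_common (U1 U2 : opens X) (h1 : opensI U1 U2 `<=` U1)
  (h2 : opensI U1 U2 `<=` U2) (w : sect (opensI U1 U2) -> \bar R) :
  Defs.separated X -> affine U1 -> affine U2 -> semival (opensI U1 U2) w ->
  exists (W : opens X) (k1 : W `<=` U1) (k2 : W `<=` U2) (u : sect W -> \bar R),
    [/\ affine W, semival W u, forall s, u (res k1 s) = w (res h1 s) &
      forall s, u (res k2 s) = w (res h2 s)].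
Proof.
move=> sepX [phi1 hphi1] [phi2 hphi2] sw.
have [sv1 sv2] := (semival_res h1 sw, semival_res h2 sw).
have [x1 c1] := center_exists sv1 hphi1; have [x2 c2] := center_exists sv2 hphi2.
have [[Ux1 _] [Ux2 _]] := (c1, c2).
have hN : opensI U1 U2 x0 by split; [exact: ff_generic Ux1|exact: ff_generic Ux2].
have x12 : x1 = x2.
  apply: (separated_affine_points sepX hphi1 hphi2 hN (semival_prime sw) Ux1 _ Ux2).
    exact/(is_centerE _ hphi1 Ux1).
  exact/(is_centerE _ hphi2 Ux2).
have Nx : opensI U1 U2 x1 by split=> //; rewrite x12.
have [f [fx hf]] := basic_open_basis hphi1 Ux1 Nx.
pose W := basic_open hphi1 f.
have Wx : W x1 by [].
have hW : W x0 := ff_generic F Wx.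
have [u [su hu]] := semival_extension sv1 hphi1 hW c1 Wx.
have k1 : W `<=` U1 by move=> y /hf/h1.
have k2 : W `<=` U2 by move=> y /hf/h2.
exists W, k1, k2, u; split=> //; first exact: basic_open_affine.
  move=> s; apply: (local_val_fun sv1 (hu _)).
  by rewrite (ff_res (h1 _ hN)); exact: local_val_sect.
move=> s; apply: (local_val_fun sv1 (hu _)).
rewrite (ff_res (h2 _ hN)).
have [t [hU [r [h [vh E vr]]]]] := local_val_exists hphi1 (h2 _ hN) s c1 Nx.2.
exists hU, r, h; split=> //=; rewrite -(semivalM0 sw (res h2 s) vh); congr (w _).
by apply: (ff_inj hN); rewrite rmorphM !(ff_res hU) (ff_res (h2 _ hN)) -E.
Qed.

End Semivaluations.

(** * Topology of pointwise convergence *)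

Section ExtendedReals.
Context (R : realType).

(** The map [expand] is an isometry from [[-1, 1]] onto the extended reals. *)
Lemma ereal_compact : compact [set: \bar R].
Proof.
have -> : [set: \bar R] = @expand R @` `[(-1), 1].
  apply/seteqP; split=> // x _; exists (contract x); last exact: contractK.
  by rewrite /= in_itv /= -ler_norml; exact: contract_le1.
apply: continuous_compact; last exact: segment_compact.
apply/subspace_continuousP => x x1; apply/cvg_ballP => e e0.
rewrite near_withinE; apply: filterS (nbhsx_ballx x e e0) => y xy y1.
have N (z : R) : z \in `[(-1), 1] -> contract (expand z) = z.
  by rewrite in_itv /= -ler_norml => z1; exact: expandK.
by rewrite /ball /= /ereal_ball !N.
Qed.

Lemma lim_eq (T : Type) (F : set_system T) (f g : T -> \bar R) (l l' : \bar R) :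
  ProperFilter F -> f x @[x --> F] --> l -> g x @[x --> F] --> l' ->
  (\forall x \near F, f x = g x) -> l = l'.
Proof.
move=> FF fl gl fg; apply: (cvg_unique (@ereal_hausdorff R) fl).
by apply: cvg_trans gl; apply: near_eq_cvg; apply: filterS fg.
Qed.

End ExtendedReals.

Section Pointwise.
Context (R : realType).

Lemma eval_continuous (A : choiceType) (a : A) :
  continuous (fun v : {ptws A -> \bar R} => v a).
Proof. exact: proj_continuous. Qed.

Lemma ptws_cvg (A : choiceType) (F : set_system {ptws A -> \bar R})
  (f : {ptws A -> \bar R}) : Filter F ->
  (forall a, g a @[g --> F] --> f a) -> F --> f.
Proof.
move=> FF cv; apply/cvg_sup => a; apply/cvg_image.
  by rewrite eqEsubset; split=> v // _; exists (cst v).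
move=> W /cv /= FW; exists (@^~ a @^-1` W) => //.
by rewrite eqEsubset; split=> [j [? + <-]//|j Wj]; exists (fun _ => j).
Qed.

Lemma precomp_continuous (A B : choiceType) (r : A -> B) :
  continuous (fun w : {ptws B -> \bar R} => (w \o r : {ptws A -> \bar R})).
Proof.
move=> w.
apply: (@ptws_cvg A ((fun v : {ptws B -> \bar R} => v \o r) @ nbhs w)).
move=> a V nV; exact: (@eval_continuous _ (r a) w V nV).
Qed.

Lemma closure_approx (A : choiceType) (B : set {ptws A -> \bar R})
  (v : {ptws A -> \bar R}) : closure B v ->
  forall (G : seq A) (eps : R), 0 < eps ->
    exists2 w : A -> \bar R, B w & forall g, g \in G -> ball (v g) eps (w g).
Proof.
move=> clv G eps e0.
have : nbhs v [set w | forall g, g \in G -> ball (v g) eps (w g)].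
  elim: G => [|g G IH].
    by apply: (@filterS _ _ (nbhs_filter v) setT); [move=> w _ g|exact: filterT].
  have nb := @eval_continuous _ g v _ (nbhsx_ballx (v g) eps e0).
  apply: (@filterS2 _ _ (nbhs_filter v) _ _ _ _ nb IH) => w hg hG h.
  by rewrite inE => /predU1P[-> //|]; exact: hG.
by move=> /clv[w [Bw hw]]; exists w.
Qed.

(** All conditions are equalities between continuous functions of the values,
    if an inequality [x <= y] is written [Order.min x y = x]; addition is
    continuous on nonnegative values. *)
Lemma semivaluation_closed (k : fieldType) (A : comPzRingType) (c : k -> A) :
  closed [set w : {ptws A -> \bar R} | semivaluation c w].
Proof.
move=> w clw; set S := [set w | _] in clw.
pose F := within S (nbhs w).
have FF : ProperFilter F by exact: within_nbhs_proper.
have ev a : v a @[v --> F] --> w a.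
  by apply: cvg_within_filter; exact: (@eval_continuous _ a w).
have inS (P : {ptws A -> \bar R} -> Prop) : (forall v, S v -> P v) ->
    \forall v \near F, P v.
  by move=> SP; rewrite near_withinE; apply: nearW.
have mc f g (l l' : \bar R) : f v @[v --> F] --> l -> g v @[v --> F] --> l' ->
    Order.min (f v) (g v) @[v --> F] --> Order.min l l'.
  by move=> fl gl; exact: (cvg_comp2 fl gl (@min_continuous _ (\bar R) (_, _))).
have w0 a : (0 <= w a)%E.
  apply/min_idPl; apply: (lim_eq FF (mc _ _ _ _ (cvg_cst _) (ev a)) (cvg_cst _)).
  by apply: inS => v sv; apply/min_idPl; exact: semival_ge0 sv a.
split=> //.
- move=> a b; apply: (lim_eq FF (ev _) (cvgeD _ (ev a) (ev b))).
    by apply: ge0_adde_def; rewrite inE.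
  by apply: inS => v sv; exact: semivalM sv a b.
- move=> a b; apply/min_idPl.
  apply: (lim_eq FF (mc _ _ _ _ (mc _ _ _ _ (ev a) (ev b)) (ev (a + b)))
    (mc _ _ _ _ (ev a) (ev b))).
  by apply: inS => v sv; apply/min_idPl; exact: semivalD sv a b.
- apply: (lim_eq FF (ev 0) (cvg_cst _)).
  by apply: inS => v sv; exact: semival0 sv.
- move=> l l0; apply: (lim_eq FF (ev (c l)) (cvg_cst _)).
  by apply: inS => v sv; exact: (semival_cst sv l0).
Qed.

End Pointwise.

(** * Charts *)

Section Charts.
Context (k : fieldType) (R : realType) (X : kscheme k) (F : function_field X).
Local Notation x0 := (ff_point F).

(** Any affine chart shares a principal open subset with one of the given
    affine opens of finite type, and embeds in its ring of sections. *)
Lemma affine_spans (U : opens X) : finite_type X -> affine U -> U x0 ->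
  exists e, spans (kcst_mor U) e.
Proof.
move=> [n [V [covV VP]]] [phi hphi] hU.
have [i Vi] := covV x0; have [[psi hpsi] fgV] := VP i.
have [f [fx hf]] := basic_open_basis hpsi Vi hU.
pose W := basic_open hpsi f.
have hW : W x0 by [].
have WV : W `<=` V i by exact: basic_open_sub.
have [e se] : exists e, spans (kcst_mor W) e.
  apply: (@spans_loc _ _ _ (kcst_mor (V i)) _ (res WV) f).
  - by move=> l; exact: kcst_res.
  - by apply: (spec_sheaf hpsi) => x.
  - exact: fin_gen_spans.
apply: (@spans_sub _ _ _ (kcst_mor U) (kcst_mor W) (res hf) e) => //.
  by move=> l; exact: kcst_res.
by move=> a b ab; apply: (ff_inj hU); rewrite -!(ff_res hU hW hf) ab.
Qed.

Lemma chart_sequence (U : opens X) (f : sect U)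
  (B : set (set_type (normalized_points R f)))
  (v : set_type (normalized_points R f)) :
  finite_type X -> affine U -> U x0 ->
  closure (set_val @` B : set {ptws sect U -> \bar R}) (set_val v) ->
  exists u : nat -> set_type (normalized_points R f),
    (forall n, B (u n)) /\ u @ \oo --> v.
Proof.
move=> ft aU hU clB; have [e se] := affine_spans ft aU hU.
have sv (w : set_type (normalized_points R f)) :
    semivaluation (kcst_mor U) (set_val w).
  by have := set_valP w; move=> [[]].
have [|u [uB cu]] := semivaluation_sequence se (sv v) _ (closure_approx clB).
  by move=> _ [w _ <-]; exact: sv.
have /choice[u' hu'] : forall n, exists w, B w /\ set_val w = u n.
  by move=> n; have [w Bw wE] := uB n; exists w.
exists u'; split=> [n|]; first by have [] := hu' n.
have cvu : (fun n => set_val (u' n) : {ptws sect U -> \bar R}) @ \oo --> set_val v.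
  have -> : (fun n => set_val (u' n) : {ptws sect U -> \bar R}) = u.
    by apply/funext => n; have [_ <-] := hu' n.
  by apply: (@ptws_cvg _ _ (u @ \oo)) => a N; exact: cu.
move=> N; rewrite nbhsE /= => -[N' [[W oW <-] Wv] N'N].
have H : \forall n \near \oo, W (set_val (u' n)).
  exact: (cvu W (open_nbhs_nbhs (conj oW Wv))).
by near=> n; apply: N'N; near: n.
Unshelve. all: by end_near.
Qed.

End Charts.

(** * Patching *)

Section Patching.
Local Open Scope quotient_scope.
Context (k : fieldType) (R : realType) (X : kscheme k) (F : function_field X).
Context (D : cartier_divisor X) (C : principal_cover D).
Local Notation x0 := (ff_point F).
Local Notation chart i := (set_type (normalized_points R (cov_eq C i))).
Local Notation point := (chart_points R C).

Lemma chart_semival i (v : chart i) :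
  semivaluation (kcst_mor (cov_open C i)) (set_val v).
Proof. by have := set_valP v; move=> [[]]. Qed.

Lemma chart_eq1 i (v : chart i) : set_val v (cov_eq C i) = 1%:E.
Proof. by have := set_valP v; move=> []. Qed.

Lemma chart_generic i (v : chart i) : cov_open C i x0.
Proof.
have [phi hphi] := cov_affine i.
by have [x [Ux _]] := center_exists (chart_semival v) hphi; exact: ff_generic Ux.
Qed.

Local Notation inter i j := (opensI (cov_open C i) (cov_open C j)).

Definition inter_sub1 i j : inter i j `<=` cov_open C i := fun x h => h.1.
Definition inter_sub2 i j : inter i j `<=` cov_open C j := fun x h => h.2.

Definition joint i j : set {ptws sect (inter i j) -> \bar R} :=
  [set w | semivaluation (kcst_mor (inter i j)) w].

Lemma same_point_data (a b : point) : same_point a b ->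
  local_data F (set_val (tagged a)) = local_data F (set_val (tagged b)).
Proof.
move=> [W [ha [hb [w [aW [sw _] hwa hwb]]]]].
have -> : set_val (tagged a) = w \o res ha by apply/funext.
have -> : set_val (tagged b) = w \o res hb by apply/funext.
by rewrite !local_data_res //; exact: cov_affine.
Qed.

Lemma patched_data (a b : point) : patched a b ->
  local_data F (set_val (tagged a)) = local_data F (set_val (tagged b)).
Proof.
move=> /asboolP; elim=> {a b} [a b|a|a b _ ->|a b c _ -> _ ->] //.
exact: same_point_data.
Qed.

(** The generated equivalence relation involves chains of identifications, but
    all points of a chain have the same local data; this gives the extension in
    one step. *)
Lemma patchedP : Defs.separated X -> forall (a b : point), patched a b <->
  exists w, [/\ @joint (tag a) (tag b) w,
    set_val (tagged a) = w \o res (@inter_sub1 (tag a) (tag b)) &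
    set_val (tagged b) = w \o res (@inter_sub2 (tag a) (tag b))].
Proof.
move=> sepX a b; split=> [/patched_data|[w [jw aE bE]]].
  move=> /(semival_common (@inter_sub1 _ _) (@inter_sub2 _ _) (@cov_affine _ _ _ C _)
    (@cov_affine _ _ _ C _) (chart_semival _) (chart_semival _))[w [sw aw bw]].
  by exists w; split=> //; apply/funext.
apply/asboolP/rst_step.
have [W [k1 [k2 [u [aW su u1 u2]]]]] := semival_affine_common F
  (@inter_sub1 _ _) (@inter_sub2 _ _) sepX (@cov_affine _ _ _ C _) (@cov_affine _ _ _ C _) jw.
exists W, k1, k2, u; split=> //.
- split=> //; rewrite u1.
  have := chart_eq1 (tagged a); rewrite aE /= => ->.
  by rewrite lte_fin ltr01 ltey.
- by move=> s; rewrite aE u1.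
- by move=> s; rewrite bE u2.
Qed.

Local Notation piX := (\pi_({eq_quot (patched_equivRel R C)})%qT :
  point -> normalized_generic_fiber R C).

Lemma pi_eqP (a b : point) : piX a = piX b <-> patched a b.
Proof. by split=> [/eqmodP|h]; [|apply/eqmodP]. Qed.

(** By [patchedP] this set is the image, under restriction to the second chart,
    of a closed set of semivaluations over the intersection, which is compact. *)
Lemma patched_closed i j (cl : set {ptws sect (cov_open C i) -> \bar R}) :
  Defs.separated X -> closed cl ->
  closed [set b : chart j | exists2 a : chart i, cl (set_val a) &
    patched (existT _ i a : point) (existT _ j b)].
Proof.
move=> sepX ccl.
set N := opensI (cov_open C i) (cov_open C j).
pose r1 : {rmorphism sect (cov_open C i) -> sect N} := res (@inter_sub1 i j).
pose r2 : {rmorphism sect (cov_open C j) -> sect N} := res (@inter_sub2 i j).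
pose Q : set {ptws sect N -> \bar R} := @joint i j `&`
  ([set w : sect N -> \bar R | w (r1 (cov_eq C i)) = 1%:E] `&`
   [set w : sect N -> \bar R | cl (w \o r1)]).
have cQ : closed Q.
  apply: closedI; first exact: semivaluation_closed.
  apply: closedI.
    apply: (@closed_comp _ _ (fun w : {ptws sect N -> \bar R} => w (r1 (cov_eq C i)))
      [set 1%:E]); first by move=> w _; exact: eval_continuous.
    exact/accessible_closed_set1/hausdorff_accessible/ereal_hausdorff.
  apply: (@closed_comp _ _ (fun w : {ptws sect N -> \bar R} =>
    (w \o r1 : {ptws sect (cov_open C i) -> \bar R}))) => //.
  by move=> w _; exact: precomp_continuous.
have compQ : compact Q.
  apply: (subclosed_compact cQ (tychonoff (fun _ : sect N => @ereal_compact R))).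
  by [].
have cim : closed ((fun w : {ptws sect N -> \bar R} =>
    (w \o r2 : {ptws sect (cov_open C j) -> \bar R})) @` Q).
  apply: compact_closed.
    exact: (@hausdorff_product _ (fun _ : sect (cov_open C j) => \bar R)
      (fun _ => @ereal_hausdorff R)).
  apply: continuous_compact compQ.
  exact/continuous_subspaceT/precomp_continuous.
have -> : [set b : chart j | exists2 a : chart i, cl (set_val a) &
    patched (existT _ i a : point) (existT _ j b)] =
  set_val @^-1` ((fun w : {ptws sect N -> \bar R} =>
    (w \o r2 : {ptws sect (cov_open C j) -> \bar R})) @` Q).
  apply/seteqP; split=> b /=.
    move=> [a cla /(patchedP sepX)[w [jw /= aE bE]]].
    exists w; last by rewrite bE.
    split=> //; split; rewrite /= ?/r1 -?aE //.
    by have := chart_eq1 a; rewrite aE.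
  move=> [w [jw [w1 clw]] wb].
  have nw : normalized_points R (cov_eq C i) (w \o r1).
    split=> //; split; first exact: semival_res.
    by rewrite /= w1 lte_fin ltr01 ltey.
  exists (exist _ (w \o r1) (mem_set nw)); first by rewrite set_valE.
  by apply/(patchedP sepX); exists w; split=> //=; rewrite ?set_valE.
apply: (@closed_comp _ _ (set_val : chart j -> {ptws sect (cov_open C j) -> \bar R})) => //.
by move=> b _; exact: initial_continuous.
Qed.

End Patching.

(** * Sequences in the patched space *)

Theorem theoremA (k : closedFieldType) (R : realType) (X : kscheme k)
  (hX : normal_variety X) (D : cartier_divisor X) (C : principal_cover D)
  (A : set (normalized_generic_fiber R C))
  (x : normalized_generic_fiber R C) (hx : closure A x) :
  exists u : nat -> normalized_generic_fiber R C,
    (forall n, A (u n)) /\ u @ \oo --> x.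
Proof.
have [F] := function_field_exists (variety_irreducible hX)
  (variety_reduced hX) (variety_normal hX).
have sepX := variety_separated hX.
pose piX (a : chart_points R C) : normalized_generic_fiber R C :=
  (\pi_({eq_quot (patched_equivRel R C)})%qT a)%qT.
have pi_cont : continuous piX by exact: pi_continuous.
pose B i : set (set_type (normalized_points R (cov_eq C i))) :=
  [set v | A (piX (existT _ i v))].
(* The closure is taken in the space of all functions on the sections, where the
   restriction maps between charts are defined. *)
pose clB i := closure (set_val @` B i : set {ptws sect (cov_open C i) -> \bar R}).
pose E i : set (normalized_generic_fiber R C) :=
  [set piX (existT _ i v) | v in [set v | clB i (set_val v)]].
have E_closed i : closed (E i).
  rewrite -openC; change (open (piX @^-1` (~` E i))).
  apply/sigT_openP => j.
  have -> : existT _ j @^-1` (piX @^-1` (~` E i)) =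
      ~` [set b : set_type (normalized_points R (cov_eq C j)) |
        exists2 a : set_type (normalized_points R (cov_eq C i)),
          clB i (set_val a) &
          patched (existT _ i a : chart_points R C) (existT _ j b)].
    apply/seteqP; split=> b /= nb.
      by move=> [a cla /pi_eqP ab]; apply: nb; exists a.
    by move=> [a cla /pi_eqP ab]; apply: nb; exists a.
  rewrite openC; apply: (patched_closed F) => //; exact: closed_closure.
have AE : A `<=` \bigcup_i E i.
  move=> y Ay; case: (repr y) (reprK y) => i v vy.
  exists i => //; exists v => //.
  by apply: subset_closure; exists v => //; rewrite /B /= /piX vy.
have [i _ [v clv vx]] : (\bigcup_i E i) x.
  have cE : closed (\bigcup_i E i).
    by apply: closed_bigcup => //; exact: finite_finset.
  by apply: cE; exact: (closure_subset AE).
have [u [uB uv]] := chart_sequence (variety_finite_type hX) (cov_affine i)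
  (chart_generic F v) clv.
exists (fun n => piX (existT _ i (u n))); split=> [n|]; first exact: uB.
have cv : continuous (fun w : set_type (normalized_points R (cov_eq C i)) =>
    piX (existT _ i w)).
  by move=> w; apply: continuous_comp; [exact: existT_continuous|exact: pi_cont].
by rewrite -vx => N Nv; exact: uv (cv v N Nv).
Qed.
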